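(* For all $k\ge1$ and all trees $\tau_0,\dots,\tau_k\in\mathcal T$, $$(\tau_k\cdots\tau_1)\curvearrowright\tau_0=\frac1{k!}\sum_{p\in\Sigma_k}\ \sum_{\rho\in\mathcal T_b^{p(I_{k-1})}}\ \sum_{\ell=1}^{m_L(\rho)+1}\ \sum_{\boldsymbol j_\ell\in\{0,\dots,k-1\}^\ell_<}(-1)^{k-m_R(\bullet_{p(k)}\to_\ell\rho)}\,J_{\rho,\ell}(\boldsymbol j_\ell)\,G(\bullet_{p(k)}\to_\ell\rho),$$ as an identity in the linear span of $\mathcal T$.
   Context: Trees and grafting. $\mathcal T$ is the set of finite non-planar rooted trees with vertices decorated by $\{1,\dots,d\}$. Forests are finite commutative products (multisets) of trees, including the empty forest $\mathbf 1$. $[w]_i$ is the tree obtained by joining the roots of the trees of a forest $w$ to a new root decorated by $i$. Grafting: $\tau\curvearrowright\mathbf 1=0$, $\tau\curvearrowright[w]_i=[\tau w+\tau\curvearrowright w]_i$, $\tau\curvearrowright(\tau_1\cdots\tau_k)=\sum_i\tau_1\cdots(\tau\curvearrowright\tau_i)\cdots\tau_k$ (extended bilinearly), and the Guin-Oudom extension $\mathbf 1\curvearrowright\tau=\tau$, $(\tau_1\cdots\tau_k)\curvearrowright\tau=\tau_1\curvearrowright((\tau_2\cdots\tau_k)\curvearrowright\tau)-(\tau_1\curvearrowright(\tau_2\cdots\tau_k))\curvearrowright\tau$. Planar binary trees. $\mathcal T_b$ is the set of planar binary trees with leaves decorated by $\mathbb N=\{0,1,\dots\}$: either a single leaf $\bullet_a$,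 or $[\rho',\rho'']$ (root with left subtree $\rho'$ and right subtree $\rho''$). For $I=(i_1,\dots,i_k)$ a string of positive integers, $\mathcal T_b^I$ is the set of $\rho\in\mathcal T_b$ with $k+1$ leaves whose decorations read from right to left are $0,i_1,\dots,i_k$ ($\mathcal T_b^\emptyset=\{\bullet_0\}$). $\Sigma_k$ is the set of permutations of $\{1,\dots,k\}$ and $p(I_{k-1})=(p(1),\dots,p(k-1))$. $m_L(\rho)$, $m_R(\rho)$ are the distances from the root to the leftmost, resp. rightmost, leaf. $G(\bullet_i)=\tau_i$, $G([\rho',\rho''])=G(\rho')\curvearrowright G(\rho'')$. Every $\rho\in\mathcal T_b$ is uniquely $\rho=[\dots[[\bullet_i,\rho_{m_L(\rho)}],\rho_{m_L(\rho)-1}],\dots,\rho_1]$. For $m_L(\rho)\ge1$, $V^-(\rho):=[\dots[\rho_{m_L(\rho)},\rho_{m_L(\rho)-1}],\dots,\rho_1]$. For $\ell\le m_L(\rho)$, $P_{\rho,\ell}:=[\dots[\bullet_i,\rho_{m_L(\rho)}],\dots,\rho_\ell]$, and $P_{\rho,m_L(\rho)+1}:=\bullet_i$. Insertion: $\bullet_j\to_\ell\rho:=[\dots[[\bullet_j,P_{\rho,\ell}],\rho_{\ell-1}],\dots,\rho_1]$, $1\le\ell\le m_L(\rho)+1$. Multi-indices $J$. $\{0,\dots,k\}^\ell_<$ is the set of strictly increasing $\ell$-tuples in $\{0,\dots,k\}$. For $\rho\in\mathcal T_b$ with $k+1$ leaves and $1\le\ell\le m_L(\rho)+1$, $J_{\rho,\ell}:\{0,\dots,k\}^\ell_<\to\mathbb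 N$ is defined recursively: $J_{\bullet_i,1}(0)=1$; otherwise, with $M:=m_L(\rho)$ and $J':=J_{V^-(\rho),M}$ (defined on $\{0,\dots,k-1\}^M_<$): $J_{\rho,1}(j)=\sum_{i_1<\dots<i_M<k}\mathbf 1_{\{i_1<j\}}J'(i_1,\dots,i_M)$; for $2\le\ell\le M$, $J_{\rho,\ell}(j_1,\dots,j_\ell)=\sum_{i_\ell<\dots<i_M<k}\mathbf 1_{\{j_\ell\le i_\ell\}}J'(j_1,\dots,j_{\ell-1},i_\ell,\dots,i_M)$; and $J_{\rho,M+1}(j_1,\dots,j_{M+1})=J'(j_1,\dots,j_M)$. *)

(* Defs.v *)
Set Warnings "-notation-overridden,-ambiguous-paths,-notation-incompatible-prefix,-redundant-canonical-projection".

From HB Require Import structures.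
From mathcomp Require Import all_boot all_order all_algebra all_fingroup.
From mathcomp Require Import generic_quotient finmap.
From mathcomp.multinomials Require Import monalg.

Set Implicit Arguments.
Unset Strict Implicit.
Unset Printing Implicit Defensive.

Import GRing.Theory.
Local Open Scope ring_scope.
Local Open Scope quotient_scope.

Inductive pltree (d : nat) := PlNode of 'I_d & seq (pltree d).

Section PlanarTree.
Variable d : nat.

Fixpoint pltree_all_ind (P : pltree d -> Prop)
    (H : forall i w, foldr (fun s => and (P s)) True w -> P (PlNode i w))
    (t : pltree d) : P t :=
  let: PlNode i w := t in
  H i w ((fix aux w : foldr (fun s => and (P s)) True w :=
    if w is s :: w' then conj (pltree_all_ind H s) (aux w') else I) w).

Fixpoint pltree_code (t : pltree d) : GenTree.tree void :=
  let: PlNode i w := t in GenTree.Node i (map pltree_code w).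

Fixpoint pltree_decode (c : GenTree.tree void) : option (pltree d) :=
  if c is GenTree.Node n cs then
    omap (fun i => PlNode i (pmap pltree_decode cs)) (insub n)
  else None.

Lemma pltree_codeK : pcancel pltree_code pltree_decode.
Proof.
elim/pltree_all_ind=> i w IH /=; rewrite valK /=; congr (Some (PlNode i _)).
by elim: w IH => //= s w IHw [-> /IHw->].
Qed.

HB.instance Definition _ := Countable.copy (pltree d) (pcan_type pltree_codeK).

(* Recursively sorts the children of every vertex, so that two planar trees
   have the same image iff they differ by reorderings of children. *)
Fixpoint canon (t : pltree d) : pltree d :=
  let: PlNode i w := t in
  PlNode i (sort (fun u v => choice.pickle u <= choice.pickle v)%N (map canon w)).

Definition pl_equiv (s t : pltree d) := canon s == canon t.

Lemma pl_equiv_refl : reflexive pl_equiv.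
Proof. by move=> x; rewrite /pl_equiv. Qed.
Lemma pl_equiv_sym : symmetric pl_equiv.
Proof. by move=> x y; rewrite /pl_equiv eq_sym. Qed.
Lemma pl_equiv_trans : transitive pl_equiv.
Proof. by rewrite /pl_equiv => y x z /eqP-> /eqP->. Qed.

Canonical pl_equiv_rel :=
  EquivRel pl_equiv pl_equiv_refl pl_equiv_sym pl_equiv_trans.

Definition tree_quot := {eq_quot pl_equiv}.
HB.instance Definition _ := Choice.on tree_quot.
HB.instance Definition _ := EqQuotient.on tree_quot.

Definition tree : choiceType := tree_quot.
Definition tree_of (u : pltree d) : tree := \pi_tree_quot u.
Definition planar (t : tree) : pltree d := repr (t : tree_quot).

(* Multisets of trees: finitely supported multiplicity functions, with the
   commutative product and the empty forest provided by [cmonom]. *)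
Definition forest : conomType := {cmonom tree}.

(* The multiplicity of t in w, and w with one occurrence of t removed. *)
Definition mult (w : forest) (t : tree) : nat := (w : {cmonom tree}) t.
Definition forest_rem (w : forest) (t : tree) : forest := divcm w (ucm t).

Definition forest1 (t : tree) : forest := ucm t.

Definition forest_of (s : seq tree) : forest :=
  \big[mmul/mone]_(t <- s) forest1 t.

Definition forest_seq (w : forest) : seq tree :=
  flatten [seq nseq (mult w t) t | t <- finsupp (w : {cmonom tree})].

Definition Bplus (i : 'I_d) (w : forest) : tree :=
  tree_of (PlNode i [seq planar t | t <- forest_seq w]).

End PlanarTree.
Arguments canon {d}.
Arguments tree_of {d}.
Arguments planar {d}.
Arguments forest_of {d}.
Arguments forest_seq {d}.

Section Grafting.
Variables (R : fieldType) (d : nat).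
Local Notation tree := (tree d).
Local Notation forest := (forest d).

(* Linear spans of trees and of forests, with the canonical bases [tvec] and
   [fvec]; the product of [forestspan] extends that of forests bilinearly. *)
Definition treespan : lmodType R := {malg R[tree]}.
Definition forestspan : comAlgType R := {malg R[forest]}.
Definition tvec (t : tree) : treespan := << t >>.
Definition fvec (w : forest) : forestspan := << w >>.

(* Linear extension of a map defined on the canonical basis. *)
Definition linext (A : choiceType) (V : lmodType R) (f : A -> V)
  (x : {malg R[A]}) : V := \sum_(a <- msupp x) x@_a *: f a.

Definition tree_ext (V : lmodType R) (f : tree -> V) (x : treespan) : V :=
  @linext tree V f x.
Definition forest_ext (V : lmodType R) (f : forest -> V) (X : forestspan) : V :=
  @linext forest V f X.

Definition tree_to_forest : treespan -> forestspan :=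
  tree_ext (fun t => fvec (forest1 t)).

Definition BplusL (i : 'I_d) : forestspan -> treespan :=
  forest_ext (fun w => tvec (Bplus i w)).

(* Grafting computed on a planar representative of the second argument; see
   [graft_Bplus] for the defining recursion on non-planar trees. *)
Fixpoint pl_graft (t : tree) (s : pltree d) : treespan :=
  let: PlNode i w := s in
  BplusL i
    (fvec (forest1 t) * fvec (forest_of [seq tree_of u | u <- w]) +
     (fix deriv w : forestspan := match w with
        | [::] => 0
        | u :: w' =>
          tree_to_forest (pl_graft t u) *
            fvec (forest_of [seq tree_of v | v <- w']) +
          fvec (forest1 (tree_of u)) * deriv w'
        end) w).

Definition tree_graft (t s : tree) : treespan := pl_graft t (planar s).

Definition graft (x y : treespan) : treespan :=
  tree_ext (fun t => tree_ext (tree_graft t) y) x.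

Definition tree_graft_forest (t : tree) (w : forest) : forestspan :=
  \sum_(s <- forest_seq w) tree_to_forest (tree_graft t s) * fvec (forest_rem w s).

Definition graft_forest (x : treespan) (Y : forestspan) : forestspan :=
  tree_ext (fun t => forest_ext (tree_graft_forest t) Y) x.

(* The tree extracted first from a forest is the head of [forest_seq]; by
   [guin_oudomM] this choice is irrelevant. The number [n] of trees serves as
   recursion bound. *)
Fixpoint guin_oudom_rec (n : nat) (w : forest) (y : treespan) : treespan :=
  match n, forest_seq w with
  | n'.+1, t :: s =>
      graft (tvec t) (guin_oudom_rec n' (forest_of s) y) -
      forest_ext (fun v => guin_oudom_rec n' v y) (tree_graft_forest t (forest_of s))
  | _, _ => y
  end.

Definition guin_oudom (X : forestspan) (y : treespan) : treespan :=
  forest_ext (fun w => guin_oudom_rec (size (forest_seq w)) w y) X.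

End Grafting.
Arguments tvec R {d}.
Arguments fvec R {d}.
Arguments tree_graft R {d}.
Arguments tree_graft_forest R {d}.
Arguments guin_oudom_rec {R d}.

Inductive btree := BLeaf of nat | BNode of btree & btree.

Fixpoint btree_code (r : btree) : GenTree.tree nat :=
  match r with
  | BLeaf a => GenTree.Leaf a
  | BNode r1 r2 => GenTree.Node 0 [:: btree_code r1; btree_code r2]
  end.

Fixpoint btree_decode (c : GenTree.tree nat) : option btree :=
  match c with
  | GenTree.Leaf a => Some (BLeaf a)
  | GenTree.Node _ [:: c1; c2] =>
      if btree_decode c1 is Some r1 then
        omap (BNode r1) (btree_decode c2) else None
  | _ => None
  end.

Lemma btree_codeK : pcancel btree_code btree_decode.
Proof. by elim=> //= r1 -> r2 ->. Qed.

HB.instance Definition _ := Countable.copy btree (pcan_type btree_codeK).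

(* Leaf decorations, from left to right. *)
Fixpoint leaves (r : btree) : seq nat :=
  match r with
  | BLeaf a => [:: a]
  | BNode r1 r2 => leaves r1 ++ leaves r2
  end.

Fixpoint mL (r : btree) : nat := if r is BNode r1 _ then (mL r1).+1 else 0.
Fixpoint mR (r : btree) : nat := if r is BNode _ r2 then (mR r2).+1 else 0.

(* All trees with leaf word [w], for [size w <= n]. *)
Fixpoint btree_enum (n : nat) (w : seq nat) : seq btree :=
  match n, w with
  | _, [:: a] => [:: BLeaf a]
  | n'.+1, _ =>
      flatten [seq [seq BNode r1 r2 | r1 <- btree_enum n' (take i w),
                                      r2 <- btree_enum n' (drop i w)]
              | i <- iota 1 (size w).-1]
  | 0, _ => [::]
  end.

(* Duplicate-free enumeration of T_b^I; see [mem_btrees] and [btrees_uniq]. *)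
Definition btrees (I : seq nat) : seq btree :=
  btree_enum (size I).+1 (rev (0%N :: I)).

(* The decomposition r = [ .. [[leaf_a, r_m], r_(m-1)], .., r_1]:
   [left_leaf r] is a and [left_comb r] is (r_1, .., r_m). *)
Fixpoint left_leaf (r : btree) : nat :=
  match r with BLeaf a => a | BNode r1 _ => left_leaf r1 end.

Fixpoint left_comb (r : btree) : seq btree :=
  match r with BLeaf _ => [::] | BNode r1 r2 => r2 :: left_comb r1 end.

(* [recomb r0 (r_1, .., r_n)] is [ .. [r0, r_n], .., r_1]. *)
Definition recomb (r0 : btree) (s : seq btree) : btree :=
  foldr (fun r acc => BNode acc r) r0 s.

Definition Vminus (r : btree) : btree :=
  recomb (last r (left_comb r)) (take (mL r).-1 (left_comb r)).

Definition Ppart (r : btree) (l : nat) : btree :=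
  recomb (BLeaf (left_leaf r)) (drop l.-1 (left_comb r)).

Definition insertion (j l : nat) (r : btree) : btree :=
  recomb (BNode (BLeaf j) (Ppart r l)) (take l.-1 (left_comb r)).

Definition increasing (k l : nat) (j : l.-tuple 'I_k) : bool :=
  sorted ltn (map val j).

(* [J_rec k r l j] is J_(r,l)(j) for a tree r with k+1 leaves; tuples of
   integers are given as sequences, and [nth 0 j (l - 1)] is j_l. *)
Fixpoint J_rec (k : nat) (r : btree) (l : nat) (j : seq nat) : nat :=
  match k with
  | 0 => ((l == 1) && (j == [:: 0]))%N
  | k'.+1 =>
      let M := mL r in
      let J' := J_rec k' (Vminus r) M in
      if l == 1%N then
        (\sum_(i : M.-tuple 'I_k | increasing i)
           (nth 0 (map val i) 0 < nth 0 j 0) * J' (map val i))%N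
      else if (l <= M)%N then
        (\sum_(i : (M - l).+1.-tuple 'I_k | increasing i)
           (nth 0 j l.-1 <= nth 0 (map val i) 0) *
           J' (take l.-1 j ++ map val i))%N
      else J' (take M j)
  end.

Definition J (r : btree) : nat -> seq nat -> nat := J_rec (size (leaves r)).-1 r.

Section Evaluation.
Variables (R : fieldType) (d : nat) (tau : nat -> tree d).

Fixpoint G (r : btree) : treespan R d :=
  match r with
  | BLeaf a => tvec R (tau a)
  | BNode r1 r2 => graft (G r1) (G r2)
  end.

End Evaluation.
Arguments G R {d}.

(* (p(1), .., p(k)), the element m of {1, .., k} being the ordinal m - 1. *)
Definition one_line (k : nat) (p : 'S_k) : seq nat := [seq (p i).+1 | i : 'I_k].

(* Main.v *)
Require Import Defs.
From mathcomp Require Import all_boot all_order all_algebra all_fingroup.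
From mathcomp Require Import generic_quotient finmap ring.
From mathcomp.multinomials Require Import monalg.

(* The identity holds in any pre-Lie algebra, applied here to the grafting product.
   Unfolding the Guin-Oudom recursion one argument at a time and summing over all
   orders of the arguments, the argument extracted first may be assumed to be either
   the last one, grafted on everything else, or to be grafted on its predecessor.
   Hence k! times the left-hand side is the sum over p of signed evaluations of
   labelled binary trees, built by adding a root or by opening a leaf into a cherry;
   the labels (the positions of the inner vertices) record the order of these steps,
   so that a tree is counted with its number of admissible labellings.
   The multi-indices J build the same labelled trees by inserting leftmost leaves,
   keeping only the labels of the left spine. Both constructions agree because their
   steps commute, except when they create the vertex with the top label, in which
   case they coincide. *)

Set Implicit Arguments.
Unset Strict Implicit.
Unset Printing Implicit Defensive.
Import GRing.Theory.
Local Open Scope ring_scope.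

(** * Linear extensions *)

Section LinearExtension.
Variables (R : fieldType) (A : choiceType) (V : lmodType R).
Implicit Types (f g : A -> V) (x y : {malg R[A]}).

(** Coefficients vanish off the support, so the sums attached to different elements can run over one
    common index set. *)
Lemma linextEw f x (D : {fset A}) : (msupp x `<=` D)%fset ->
  linext f x = \sum_(a <- D) x@_a *: f a.
Proof.
move=> sxD; rewrite /linext; apply: big_fset_incl => // a _ aNx.
by rewrite mcoeff_outdom // scale0r.
Qed.

Lemma linext_is_linear f : linear (linext f).
Proof.
move=> c x y.
have sub : (msupp (c *: x + y) `<=` msupp x `|` msupp y)%fset.
  apply: fsubset_trans (msuppD_le _ _) _.
  by apply: fsetSU; apply: msuppZ_le.
rewrite (linextEw f sub) (linextEw f (fsubsetUl _ (msupp y))).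
rewrite (linextEw f (fsubsetUr (msupp x) _)) scaler_sumr -big_split /=.
by apply: eq_bigr => a _; rewrite mcoeffD mcoeffZ scalerDl scalerA.
Qed.

Lemma linextU f a : linext f << a >> = f a.
Proof. by rewrite /linext msuppU oner_eq0 big_seq_fset1 mcoeffUU scale1r. Qed.

Lemma malg_ind (P : {malg R[A]} -> Prop) :
    P 0 -> (forall c a x, P x -> P (c *: << a >> + x)) -> forall x, P x.
Proof.
move=> P0 PD x.
have -> : x = \sum_(a <- msupp x) x@_a *: << a >>.
  rewrite {1}[x]monalgE; apply: eq_bigr => a _; apply/malgP => b.
  by rewrite mcoeffZ !mcoeffU mulrnAr mulr1.
by elim: (enum_fset _) => [|a s IH]; rewrite ?big_nil // big_cons; apply: PD.
Qed.

End LinearExtension.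

(** * Forests and non-planar trees *)

Section Forests.
Variable d : nat.
Implicit Types (t u : tree d) (w : forest d) (s : seq (tree d)).

Lemma count_forest_seq t w : count_mem t (forest_seq w) = mult w t.
Proof.
rewrite /forest_seq count_flatten -map_comp sumnE big_map.
have count_nseq u : (count_mem t \o (fun v => nseq (mult w v) v)) u =
    (mult w u * (u == t))%N.
  by rewrite /= count_nseq mulnC.
under eq_bigr => u _ do rewrite count_nseq.
have [tw|tNw] := boolP (t \in finsupp (w : {cmonom tree d})).
  rewrite (big_fsetD1 t) //= eqxx muln1 big_seq big1 ?addn0 // => u.
  by rewrite !inE => /andP[/negPf-> _]; rewrite muln0.
rewrite big_seq big1 => [|u uw].
  by rewrite /mult; apply/esym/eqP; rewrite cmE_eq0.
by case: eqP uw => [->|]; rewrite ?(negPf tNw) ?muln0.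
Qed.

Lemma forest_of_cons t s : forest_of (t :: s) = mmul (forest1 t) (forest_of s).
Proof. by rewrite /forest_of big_cons. Qed.

Lemma mult_forest_of s t : mult (forest_of s) t = count_mem t s.
Proof.
elim: s => [|u s IH]; first by rewrite /forest_of big_nil /mult cm1.
rewrite forest_of_cons /mult cmM /= -IH /forest1.
by rewrite cmU.
Qed.

Lemma perm_forest_seq s : perm_eq (forest_seq (forest_of s)) s.
Proof.
by apply/allP => t _ /=; rewrite count_forest_seq mult_forest_of.
Qed.

Lemma perm_forest_of s1 s2 : perm_eq s1 s2 -> forest_of s1 = forest_of s2.
Proof. by move=> s12; apply: perm_big. Qed.

Lemma forest_seqK : cancel (@forest_seq d) forest_of.
Proof.
move=> w; apply/eqP/cmP => t.
by rewrite -!/(mult _ t) mult_forest_of count_forest_seq.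
Qed.

Lemma perm_forest_seqM t w :
  perm_eq (forest_seq (mmul (forest1 t) w)) (t :: forest_seq w).
Proof. by rewrite -{1}[w]forest_seqK -forest_of_cons perm_forest_seq. Qed.

Lemma forest_remK t w : forest_rem (mmul (forest1 t) w) t = w.
Proof.
apply/eqP/cmP => u.
by rewrite divcmE cmM addKn.
Qed.

(** Division of forests truncates multiplicities at zero: for [t = u] the two sides differ when [t]
    does not occur in [w]. *)
Lemma forest_remM t u w : t \in forest_seq w ->
  forest_rem (mmul (forest1 u) w) t = mmul (forest1 u) (forest_rem w t).
Proof.
rewrite -has_pred1 has_count count_forest_seq => w_t.
apply/eqP/cmP => v; rewrite divcmE !cmM divcmE addnBA //.
by rewrite cmU; case: eqP => // <-.
Qed.

End Forests.

Section Trees.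
Variable d : nat.
Implicit Types (t u : tree d) (w : seq (pltree d)).

Lemma pltree_ind_in (P : pltree d -> Prop) :
    (forall i (w : seq (pltree d)), {in w, forall v, P v} -> P (PlNode i w)) -> forall v, P v.
Proof.
move=> PN; elim/pltree_all_ind => i w IH; apply: PN.
elim: w IH => //= u w IHw [Pu /IHw Pw] v.
by rewrite inE => /predU1P[->|/Pw].
Qed.

Lemma planarK : cancel planar (@tree_of d).
Proof. by move=> t; apply: (@reprK _ (tree_quot d)). Qed.

Lemma tree_of_eqP (u v : pltree d) : reflect (tree_of u = tree_of v) (canon u == canon v).
Proof. exact: (@eqmodP (pltree d) (pl_equiv_rel d)). Qed.

Lemma canon_PlNode i (w1 w2 : seq (pltree d)) :
  perm_eq (map canon w1) (map canon w2) -> canon (PlNode i w1) = canon (PlNode i w2).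
Proof.
move=> w12 /=; congr PlNode; apply/perm_sortP => //.
- by move=> u v; apply: leq_total.
- by move=> u v z; apply: leq_trans.
(* Antisymmetry of the comparison comes from the injectivity of [pickle]. *)
- move=> u v uv; apply: (pcan_inj (@choice.pickleK (pltree d))).
  exact: anti_leq.
Qed.

Lemma canon_idem (u : pltree d) : canon (canon u) = canon u.
Proof.
elim/pltree_ind_in: u => i w IH.
rewrite {2 3}/canon -/canon; apply: canon_PlNode.
apply: perm_trans (perm_map _ (permEl (perm_sort _ _))) _.
rewrite -map_comp; suff /eq_in_map-> : {in w, canon \o canon =1 canon} by [].
exact: IH.
Qed.

Lemma tree_of_canon (u : pltree d) : tree_of (canon u) = tree_of u.
Proof. by apply/tree_of_eqP; rewrite canon_idem. Qed.

(** [Bplus] reorders the branches and replaces them by chosen representatives; [canon] is blind to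
    both changes. *)
Lemma tree_of_PlNode i w : tree_of (PlNode i w) = Bplus i (forest_of (map tree_of w)).
Proof.
apply/tree_of_eqP/eqP/canon_PlNode.
rewrite perm_sym; apply: perm_trans (perm_map _ (perm_map _ (perm_forest_seq _))) _.
rewrite -!map_comp.
suff -> : [seq (canon \o (planar \o tree_of (d:=d))) v | v <- w] = map canon w by [].
by apply: eq_map => v; apply/eqP/tree_of_eqP; rewrite /= planarK.
Qed.

Lemma tree_ind (P : tree d -> Prop) :
    (forall i (w : forest d), {in forest_seq w, forall t, P t} -> P (Bplus i w)) ->
  forall t, P t.
Proof.
move=> PB t; rewrite -[t]planarK.
elim/pltree_ind_in: (planar t) => i w IH; rewrite tree_of_PlNode.
apply: PB => u; rewrite (perm_mem (perm_forest_seq _)) => /mapP[v vw ->].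
exact: IH.
Qed.

End Trees.

(** * The pre-Lie and Guin-Oudom identities in abstract form *)

Section LinearMaps.
Variable R : fieldType.
Implicit Types U V W : lmodType R.

Lemma lin0 U V (f : U -> V) : linear f -> f 0 = 0.
Proof. by move=> lf; have := lf (-1) 0 0; rewrite !scaler0 addr0 scaleN1r addNr. Qed.

Lemma linD U V (f : U -> V) : linear f -> {morph f : x y / x + y}.
Proof. by move=> lf x y; have := lf 1 x y; rewrite !scale1r. Qed.

Lemma linB U V (f : U -> V) : linear f -> {morph f : x y / x - y}.
Proof.
by move=> lf x y; rewrite [x - y]addrC -[- y]scaleN1r lf scaleN1r addrC.
Qed.

Lemma linear_comp U V W (f : V -> W) (g : U -> V) :
  linear f -> linear g -> linear (fun x => f (g x)).
Proof. by move=> lf lg c x y; rewrite lg lf. Qed.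

Lemma linear_add U V (f g : U -> V) :
  linear f -> linear g -> linear (fun x => f x + g x).
Proof. by move=> lf lg c x y; rewrite lf lg scalerDr addrACA. Qed.

Lemma linear_sub U V (f g : U -> V) :
  linear f -> linear g -> linear (fun x => f x - g x).
Proof. by move=> lf lg c x y; rewrite lf lg scalerBr opprD addrACA. Qed.

Lemma linear_scale U V (a : R) (f : U -> V) : linear f -> linear (fun x => a *: f x).
Proof. by move=> lf c x y; rewrite lf scalerDr !scalerA mulrC. Qed.

Lemma linear_mull U (F : comAlgType R) (a : F) (f : U -> F) :
  linear f -> linear (fun x => a * f x).
Proof. by move=> lf c x y; rewrite lf mulrDr scalerAr. Qed.

Lemma linear_mulr U (F : comAlgType R) (a : F) (f : U -> F) :
  linear f -> linear (fun x => f x * a).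
Proof. by move=> lf c x y; rewrite lf mulrDl scalerAl. Qed.

(** Spanning is expressed by the uniqueness of linear extensions, the form in which it is
    applied. *)
Definition spanning (A : Type) V (e : A -> V) := forall W (f g : V -> W),
  linear f -> linear g -> (forall a, f (e a) = g (e a)) -> f =1 g.

Lemma span_malg (A : choiceType) :
  spanning (fun a : A => (<< a >> : {malg R[A]})).
Proof.
move=> W f g lf lg fg; apply: malg_ind => [|c a x IH]; first by rewrite !lin0.
by rewrite lf lg fg IH.
Qed.

End LinearMaps.

Section GraftingAlgebra.
Variables (R : fieldType) (I : Type) (tree : eqType).
Variables (T : lmodType R) (F : comAlgType R).
Variables (tv : tree -> T) (iota : T -> F) (B : I -> F -> T).
Variables (gr : T -> T -> T) (D : T -> F -> F).

Hypothesis linear_iota : linear iota.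
Hypothesis linear_B : forall i, linear (B i).
Hypothesis linear_grl : forall y, linear (gr^~ y).
Hypothesis linear_grr : forall x, linear (gr x).
Hypothesis linear_Dl : forall Y, linear (D^~ Y).
Hypothesis linear_Dr : forall x, linear (D x).

Definition monomial (s : seq tree) : F := \prod_(t <- s) iota (tv t).

Hypothesis span_tv : spanning tv.
Hypothesis span_monomial : spanning monomial.
Hypothesis D_1 : forall x, D x 1 = 0.
Hypothesis D_cons : forall t u s, D (tv t) (monomial (u :: s)) =
  iota (gr (tv t) (tv u)) * monomial s + iota (tv u) * D (tv t) (monomial s).
Hypothesis gr_Bplus : forall t i s, gr (tv t) (B i (monomial s)) =
  B i (iota (tv t) * monomial s + D (tv t) (monomial s)).
Hypothesis tree_ind : forall P : tree -> Prop,
  (forall i (s : seq tree) t, {in s, forall u, P u} -> tv t = B i (monomial s) -> P t) ->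
  forall t, P t.

Lemma monomial_cons t s : monomial (t :: s) = iota (tv t) * monomial s.
Proof. exact: big_cons. Qed.

Lemma perm_monomial s1 s2 : perm_eq s1 s2 -> monomial s1 = monomial s2.
Proof. exact: perm_big. Qed.

(** By linearity [x] is a tree and [Y] a monomial; [D_cons], extended linearly to any cofactor, then
    peels off one tree at a time. *)
Lemma D_mul x Y Z : D x (Y * Z) = D x Y * Z + Y * D x Z.
Proof.
apply: (span_tv (f := fun x => D x (Y * Z)) (g := fun x => D x Y * Z + Y * D x Z)) => [||t].
- exact: linear_Dl.
- apply: linear_add; [exact: linear_mulr|exact: linear_mull].
apply: (span_monomial (f := fun Y => D (tv t) (Y * Z))
  (g := fun Y => D (tv t) Y * Z + Y * D (tv t) Z)) => [||s].
- by apply: linear_comp => //; apply: linear_mulr.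
- by apply: linear_add; apply: linear_mulr.
elim: s Z => [|u s IH] Z; first by rewrite /monomial big_nil D_1 !mul1r mul0r add0r.
have D_consX X : D (tv t) (iota (tv u) * X) =
    iota (gr (tv t) (tv u)) * X + iota (tv u) * D (tv t) X.
  apply: (span_monomial (f := fun X => D (tv t) (iota (tv u) * X)) (g := fun X =>
    iota (gr (tv t) (tv u)) * X + iota (tv u) * D (tv t) X)) => [||s'].
  - by apply: linear_comp => //; apply: linear_mull.
  - by apply: linear_add; apply: linear_mull.
  - by rewrite -monomial_cons D_cons.
by rewrite D_cons monomial_cons -mulrA D_consX IH; ring.
Qed.

Lemma D_iota x y : D x (iota y) = iota (gr x y).
Proof.
apply: (span_tv (f := fun x => D x (iota y)) (g := fun x => iota (gr x y))) => [||t].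
- exact: linear_Dl.
- exact: (linear_comp (g := gr^~ y)).
apply: (span_tv (f := fun y => D (tv t) (iota y)) (g := fun y => iota (gr (tv t) y))) => [||u].
- exact: linear_comp.
- exact: linear_comp.
have mon1 v : iota (tv v) = monomial [:: v] by rewrite /monomial big_seq1.
by rewrite mon1 D_cons /monomial big_nil D_1 mulr1 mulr0 addr0.
Qed.

Lemma gr_B x i Y : gr x (B i Y) = B i (iota x * Y + D x Y).
Proof.
apply: (span_tv (f := fun x => gr x (B i Y)) (g := fun x => B i (iota x * Y + D x Y))) => [||t].
- exact: linear_grl.
- by apply: linear_comp => //; apply: linear_add => //; apply: linear_mulr.
apply: (span_monomial (f := fun Y => gr (tv t) (B i Y))
  (g := fun Y => B i (iota (tv t) * Y + D (tv t) Y))) => [||s].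
- exact: linear_comp.
- by apply: linear_comp => //; apply: linear_add => //; apply: linear_mull.
exact: gr_Bplus.
Qed.

(** The associator up to sign; its symmetry in [x] and [y] is the pre-Lie identity. *)
Definition gr_assoc x y z := gr x (gr y z) - gr (gr x y) z.
Definition D_assoc x y Z := D x (D y Z) - D (gr x y) Z.

(** A composite of two derivations fails to be a derivation only by cross terms, and these are
    symmetric in [x] and [y]. *)
Lemma D_assoc_mul x y Y Z : D_assoc x y (Y * Z) =
  D_assoc x y Y * Z + Y * D_assoc x y Z + (D x Y * D y Z + D y Y * D x Z).
Proof. by rewrite /D_assoc !D_mul (linD (linear_Dr x)) !D_mul; ring. Qed.

Lemma D_assoc_iota x y z : D_assoc x y (iota z) = iota (gr_assoc x y z).
Proof. by rewrite /D_assoc !D_iota -(linB linear_iota). Qed.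

Lemma linear_gr_assoc x y : linear (gr_assoc x y).
Proof. by apply: linear_sub => //; apply: linear_comp. Qed.

Lemma linear_D_assoc x y : linear (D_assoc x y).
Proof. by apply: linear_sub => //; apply: linear_comp. Qed.

Lemma D_assoc_monomialC x y (s : seq tree) :
  {in s, forall t, gr_assoc x y (tv t) = gr_assoc y x (tv t)} ->
  D_assoc x y (monomial s) = D_assoc y x (monomial s).
Proof.
elim: s => [|t s IH] sym.
  by rewrite /D_assoc /monomial big_nil !D_1 (lin0 (linear_Dr x)) (lin0 (linear_Dr y)).
rewrite monomial_cons !D_assoc_mul !D_assoc_iota sym ?mem_head // IH; last first.
  by move=> u us; apply: sym; rewrite inE us orbT.
by congr (_ + _); rewrite addrC.
Qed.

(* B+ being compatible with grafting, the associator of a tree reduces to that of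
   the forest of its branches, up to terms symmetric in [x] and [y]. *)
Lemma gr_assocC x y z : gr_assoc x y z = gr_assoc y x z.
Proof.
apply: (span_tv (linear_gr_assoc x y) (linear_gr_assoc y x)) => {z} t.
elim/tree_ind: t => i s t IH ->.
rewrite /gr_assoc !gr_B -!(linB (linear_B i)); congr (B i _).
rewrite !(linD (linear_Dr _)) !D_mul !D_iota.
have := D_assoc_monomialC IH; rewrite /D_assoc => DC.
have -> : D x (D y (monomial s)) =
    D y (D x (monomial s)) - D (gr y x) (monomial s) + D (gr x y) (monomial s).
  by rewrite -DC subrK.
by ring.
Qed.

Lemma D_assocC x y Z : D_assoc x y Z = D_assoc y x Z.
Proof.
apply: (span_monomial (linear_D_assoc x y) (linear_D_assoc y x)) => {Z} s.
by apply: D_assoc_monomialC => t _; apply: gr_assocC.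
Qed.

(** Grafting on a forest preserves its number of trees, so [D x (monomial s)] is a combination of
    monomials of length [n]. *)
Lemma eq_linear_D_monomial (V : lmodType R) (f g : F -> V) x n :
    linear f -> linear g ->
    (forall s : seq tree, size s = n -> f (monomial s) = g (monomial s)) ->
  forall s, size s = n -> f (D x (monomial s)) = g (D x (monomial s)).
Proof.
(* The maps are generalized because the head [u] is absorbed into [f] and [g]. *)
move=> lf lg fg s; elim: s => [|u s IH] in n f g lf lg fg * => szs.
  by rewrite /monomial big_nil D_1 !lin0.
rewrite monomial_cons D_mul D_iota (linD lf) (linD lg); congr (_ + _).
  apply: (span_tv (f := fun z => f (iota z * monomial s))
    (g := fun z => g (iota z * monomial s))) => [||t].
  - by apply: linear_comp => //; apply: linear_mulr.
  - by apply: linear_comp => //; apply: linear_mulr.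
  by rewrite -monomial_cons; apply: fg; rewrite -szs.
case: n szs fg => // n [szs] fg.
apply: (IH n (fun X => f (iota (tv u) * X)) (fun X => g (iota (tv u) * X))) => //.
- by apply: linear_comp => //; apply: linear_mull.
- by apply: linear_comp => //; apply: linear_mull.
by move=> s' szs'; rewrite -monomial_cons; apply: fg; rewrite /= szs'.
Qed.

(** * Independence of the Guin-Oudom recursion from the extracted tree *)

Section GuinOudom.
Variables (GO : F -> T).
Hypothesis linear_GO : linear GO.
Hypothesis GO_rec : forall s, s != [::] -> exists t s', perm_eq s (t :: s') /\
  GO (monomial s) = gr (tv t) (GO (monomial s')) - GO (D (tv t) (monomial s')).

Let GO_rule x W := GO (iota x * W) = gr x (GO W) - GO (D x W).

Lemma linear_GO_mul x : linear (fun W => GO (iota x * W)).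
Proof. by apply: linear_comp => //; apply: linear_mull. Qed.

Lemma linear_GO_rhs x : linear (fun W => gr x (GO W) - GO (D x W)).
Proof. by apply: linear_sub; apply: linear_comp. Qed.

Lemma GO_tv_linear s : (forall t, GO_rule (tv t) (monomial s)) ->
  forall x, GO_rule x (monomial s).
Proof.
move=> rule_s; apply: (span_tv (f := fun x => GO (iota x * monomial s))
  (g := fun x => gr x (GO (monomial s)) - GO (D x (monomial s)))) => //.
- by apply: linear_comp => //; apply: linear_mulr.
- by apply: linear_sub => //; apply: (linear_comp (g := D^~ _)).
Qed.

(** The recursion may extract some [u] instead of [t]. Expanding once more by the other tree, the
    two results differ by exchanging [t] and [u] in an associator of [gr] and in one of [D], both of
    which are symmetric. *)
Lemma GO_tv_monomial t s : GO_rule (tv t) (monomial s).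
Proof.
elim: {s}(size s) {-2}s (erefl (size s)) => [|n IH] s szs in t *.
  rewrite /GO_rule -monomial_cons; have [//|u [s' [ps' ->]]] := @GO_rec (t :: s).
  have /perm_size := ps'; rewrite /= szs => -[] /esym/size0nil s'0.
  move: ps'; rewrite s'0 (size0nil szs) => /perm_mem/(_ t).
  by rewrite !inE eqxx => /esym/eqP->.
have [//|u [s2 [ps2 rec]]] := @GO_rec (t :: s).
have [eq_ut|neq_ut] := eqVneq u t.
  rewrite eq_ut in ps2 rec.
  have ps : perm_eq s s2 by rewrite -(perm_cons t).
  by rewrite /GO_rule -monomial_cons rec (perm_monomial ps).
have us : u \in s.
  have : u \in t :: s by rewrite (perm_mem ps2) mem_head.
  by rewrite inE (negPf neq_ut).
(* [s3] is what remains when both [t] and [u] are removed. *)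
have ps := perm_to_rem us; set s3 := rem u s in ps.
have sz3 : size s3 = n by have := perm_size ps; rewrite /= szs => -[].
have ps3 : perm_eq s2 (t :: s3).
  rewrite -(perm_cons u) -(permPl ps2); apply: perm_trans (_ : perm_eq _ (t :: u :: s3)) _.
    by rewrite perm_cons.
  exact: permEl (perm_catCA [:: t] [:: u] s3).
rewrite /GO_rule -monomial_cons rec (perm_monomial ps3) (perm_monomial ps).
rewrite !monomial_cons !D_mul !D_iota !(linD linear_GO).
(* Terms with a tree grafted on [s3] still have [n] factors, so the induction hypothesis covers
   them. *)
have hom x v := eq_linear_D_monomial x (linear_GO_mul (tv v)) (linear_GO_rhs (tv v))
   (fun s sz => IH s sz v) sz3.
have D_rule x v : GO_rule (tv v) (D x (monomial s3)) by apply: hom.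
have IHx x := GO_tv_linear (IH s3 sz3) x.
rewrite !D_rule !(IH _ sz3) !IHx.
(* Here [a - b] is the associator applied to [GO (monomial s3)], [x + z] is symmetric in [t] and
   [u], and [y + w] is symmetric by [D_assocC]. *)
have regroup (V : zmodType) (a x b y z w : V) :
    a - x - (b - y + (z - w)) = a - b - (x + z) + (y + w).
  by rewrite !opprD !opprK (AC (2*(2*2)) (1*3*(2*5)*(4*6))).
rewrite !(linB (linear_grr _)) !regroup -!(linD linear_GO).
rewrite -!/(gr_assoc _ _ _) gr_assocC [X in _ - X]addrC; congr (_ + GO _).
have := D_assocC (tv u) (tv t) (monomial s3); rewrite /D_assoc => DC.
rewrite -[D (tv u) (D (tv t) _)](subrK (D (gr (tv u) (tv t)) (monomial s3))) DC.
by ring.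
Qed.

Lemma GO_mul x W : GO (iota x * W) = gr x (GO W) - GO (D x W).
Proof.
apply: (span_monomial (linear_GO_mul x) (linear_GO_rhs x)) => {W} s.
exact: (GO_tv_linear (GO_tv_monomial ^~ s)).
Qed.

End GuinOudom.
End GraftingAlgebra.

(** * Grafting of non-planar trees *)

Section Grafting.
Variables (R : fieldType) (d : nat).
Local Notation tree := (tree d).
Local Notation forest := (forest d).
Local Notation treespan := (treespan R d).
Local Notation forestspan := (forestspan R d).
Local Notation tvec := (@tvec R d).
Local Notation fvec := (@fvec R d).
Local Notation iota := (@tree_to_forest R d).
Implicit Types (t u : tree).

Lemma tree_extE (V : lmodType R) (f : tree -> V) t : tree_ext f (tvec t) = f t.
Proof. exact: linextU. Qed.

Lemma forest_extE (V : lmodType R) (f : forest -> V) w : forest_ext f (fvec w) = f w.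
Proof. exact: linextU. Qed.

Lemma span_tvec : spanning (tvec : tree -> treespan).
Proof. exact: span_malg. Qed.

Lemma span_fvec : spanning (fvec : forest -> forestspan).
Proof. exact: span_malg. Qed.

Lemma tree_to_forestE t : iota (tvec t) = fvec (forest1 t).
Proof. exact: tree_extE. Qed.

Lemma BplusLE i w : BplusL i (fvec w) = tvec (Bplus i w).
Proof. exact: forest_extE. Qed.

Lemma fvecM v w : fvec (mmul v w) = fvec v * fvec w.
Proof. by rewrite malgM_def fgmulUU mulr1. Qed.

Lemma fvec1 : fvec (mone : forest) = 1.
Proof. by []. Qed.

Lemma fvec_cons t w : fvec (mmul (forest1 t) w) = iota (tvec t) * fvec w.
Proof. by rewrite fvecM tree_to_forestE. Qed.

Lemma linear_tree_ext (V W : lmodType R) (f : tree -> W -> V) :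
  (forall t, linear (f t)) -> forall x, linear (fun y : W => tree_ext (f^~ y) x).
Proof.
move=> lin_f x c y z; apply: (span_tvec (f := tree_ext (f^~ (c *: y + z)))
  (g := fun x => c *: tree_ext (f^~ y) x + tree_ext (f^~ z) x)) => [||t].
- exact: linext_is_linear.
- by apply: linear_add; [apply: linear_scale|]; apply: linext_is_linear.
by rewrite !tree_extE lin_f.
Qed.

Lemma linear_tree_to_forest : linear iota.
Proof. exact: linext_is_linear. Qed.

Lemma linear_BplusL i : linear (BplusL i : forestspan -> treespan).
Proof. exact: linext_is_linear. Qed.

Lemma linear_graftl (y : treespan) : linear (fun x : treespan => graft x y).
Proof. exact: linext_is_linear. Qed.

Lemma linear_graftr (x : treespan) : linear (graft x).
Proof. by apply: linear_tree_ext => t; apply: linext_is_linear. Qed.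

Lemma linear_graft_forestl (Y : forestspan) : linear (fun x : treespan => graft_forest x Y).
Proof. exact: linext_is_linear. Qed.

Lemma linear_graft_forestr (x : treespan) : linear (graft_forest x).
Proof. by apply: linear_tree_ext => t; apply: linext_is_linear. Qed.

Lemma graftE t u : graft (tvec t) (tvec u) = tree_graft R t u.
Proof. by rewrite /graft !tree_extE. Qed.

Lemma graft_forestE t w : graft_forest (tvec t) (fvec w) = tree_graft_forest R t w.
Proof. by rewrite /graft_forest tree_extE forest_extE. Qed.

Lemma tree_graft_forestM t u w :
  tree_graft_forest R t (mmul (forest1 u) w) =
  iota (tree_graft R t u) * fvec w + fvec (forest1 u) * tree_graft_forest R t w.
Proof.
rewrite /tree_graft_forest (perm_big _ (perm_forest_seqM u w)) big_cons forest_remK.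
congr (_ + _); rewrite mulr_sumr; apply: eq_big_seq => v vw.
by rewrite (forest_remM _ vw) fvecM mulrCA.
Qed.

Lemma tree_graft_forest1 t : tree_graft_forest R t (mone : forest) = 0.
Proof.
have -> : (mone : forest) = forest_of [::] by rewrite /forest_of big_nil.
by rewrite /tree_graft_forest (perm_big _ (perm_forest_seq [::])) big_nil.
Qed.

Lemma graft_forest1 (x : treespan) : graft_forest x 1 = 0.
Proof.
apply: (span_tvec (f := fun x => graft_forest x 1) (g := fun=> 0)) => [||t].
- exact: linear_graft_forestl.
- by move=> c y z; rewrite scaler0 addr0.
by rewrite -fvec1 graft_forestE tree_graft_forest1.
Qed.

(** A named copy of the inner fixpoint of [pl_graft], convertible with it. *)
Definition pl_deriv t : seq (pltree d) -> forestspan :=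
  fix deriv w := match w with
  | [::] => 0
  | u :: w' =>
    iota (pl_graft R t u) * fvec (forest_of [seq tree_of v | v <- w']) +
    fvec (forest1 (tree_of u)) * deriv w'
  end.

Lemma pl_graftE t i ws : pl_graft R t (PlNode i ws) =
  BplusL i (fvec (forest1 t) * fvec (forest_of (map tree_of ws)) + pl_deriv t ws).
Proof. by []. Qed.

(** Omitting the position of [u] amounts to removing one copy of [tree_of u] from the forest; in
    this form the order of the branches is visibly irrelevant. *)
Lemma pl_derivE t (ws : seq (pltree d)) : pl_deriv t ws =
  \sum_(u <- ws) iota (pl_graft R t u) *
                 fvec (forest_rem (forest_of (map tree_of ws)) (tree_of u)).
Proof.
elim: ws => [|u ws IH]; first by rewrite big_nil.
rewrite big_cons /= {}IH forest_of_cons forest_remK; congr (_ + _).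
rewrite mulr_sumr; apply: eq_big_seq => v vws.
rewrite forest_remM; first by rewrite fvecM mulrCA.
by rewrite (perm_mem (perm_forest_seq _)) map_f.
Qed.

(** Sorting the branches only permutes the sum of [pl_derivE], and induction handles each branch;
    hence [pl_graft] descends to non-planar trees. *)
Lemma pl_graft_canon t (u : pltree d) : pl_graft R t (canon u) = pl_graft R t u.
Proof.
elim/pltree_ind_in: u => i ws IH; rewrite [canon _]/= !pl_graftE !pl_derivE.
set ws' := sort _ _.
have pws : perm_eq ws' (map canon ws) by apply/permPl/perm_sort.
have -> : forest_of (map tree_of ws') = forest_of (map tree_of ws).
  rewrite (perm_forest_of (perm_map _ pws)) -map_comp; congr forest_of.
  by apply: eq_map => u; rewrite /= tree_of_canon.
rewrite (perm_big _ pws) big_map; apply: (congr1 (fun X => BplusL i (_ + X))).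
by apply: eq_big_seq => u uws; rewrite (IH u uws) tree_of_canon.
Qed.

Lemma tree_graft_tree_of t (u : pltree d) : tree_graft R t (tree_of u) = pl_graft R t u.
Proof.
rewrite /tree_graft -pl_graft_canon -[RHS]pl_graft_canon.
by congr pl_graft; apply/eqP/tree_of_eqP; rewrite planarK.
Qed.

Lemma tree_graft_Bplus t i w : tree_graft R t (Bplus i w) =
  BplusL i (fvec (forest1 t) * fvec w + tree_graft_forest R t w).
Proof.
rewrite tree_graft_tree_of pl_graftE pl_derivE -map_comp big_map.
rewrite (eq_map (@planarK d)) map_id forest_seqK.
apply: (congr1 (fun X => BplusL i (_ + X))).
by apply: eq_bigr => u _; rewrite planarK.
Qed.

Local Notation monom := (monomial tvec iota).

Lemma monomE s : monom s = fvec (forest_of s).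
Proof.
rewrite /monomial; elim: s => [|t s IH]; first by rewrite /forest_of !big_nil.
by rewrite forest_of_cons fvec_cons big_cons IH.
Qed.

Lemma span_monom : spanning (monom : seq tree -> forestspan).
Proof.
move=> V f g lf lg fg; apply: (span_fvec lf lg) => w.
by rewrite -[w]forest_seqK -monomE; apply: fg.
Qed.

Lemma graft_forest_cons t u s : graft_forest (tvec t) (monom (u :: s)) =
  iota (graft (tvec t) (tvec u)) * monom s +
  iota (tvec u) * graft_forest (tvec t) (monom s).
Proof.
rewrite (monomE (u :: s)) forest_of_cons (graft_forestE t (mmul _ _)) (monomE s).
by rewrite (graft_forestE t (forest_of s)) (graftE t u) (tree_to_forestE u) tree_graft_forestM.
Qed.

Lemma graft_Bplus t i s : graft (tvec t) (BplusL i (monom s)) =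
  BplusL i (iota (tvec t) * monom s + graft_forest (tvec t) (monom s)).
Proof.
rewrite monomE (BplusLE i) (graftE t) tree_graft_Bplus (tree_to_forestE t).
by rewrite (graft_forestE t).
Qed.

Lemma tree_ind_monom (P : tree -> Prop) :
  (forall i (s : seq tree) t, {in s, forall u, P u} ->
     tvec t = BplusL i (monom s) -> P t) ->
  forall t, P t.
Proof.
move=> PB; elim/tree_ind => i w IH; apply: (PB i (forest_seq w)) => //.
by rewrite monomE forest_seqK BplusLE.
Qed.

Lemma linear_guin_oudom (y : treespan) : linear (fun X : forestspan => guin_oudom X y).
Proof. exact: linext_is_linear. Qed.

Lemma guin_oudom_fvec w (y : treespan) :
  guin_oudom (fvec w) y = guin_oudom_rec (size (forest_seq w)) w y.
Proof. exact: forest_extE. Qed.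

Lemma guin_oudom_monom (y : treespan) s : s != [::] ->
  exists t s', perm_eq s (t :: s') /\ guin_oudom (monom s) y =
    graft (tvec t) (guin_oudom (monom s') y) - guin_oudom (graft_forest (tvec t) (monom s')) y.
Proof.
move=> s_neq0; rewrite !monomE guin_oudom_fvec.
have := perm_forest_seq s; case Ds: (forest_seq _) => [|t s'] ps.
  by rewrite perm_sym in ps; rewrite (perm_nilP ps) in s_neq0.
exists t, s'; split; first by rewrite perm_sym.
rewrite monomE guin_oudom_fvec (perm_size (perm_forest_seq s')) /= Ds graft_forestE.
rewrite -graft_forestE -monomE; apply: (congr1 (fun X => _ - X)).
(* The recursion runs with bound [size s'] on every forest of the correction term; as grafting
   preserves the number of trees, this is the bound prescribed by [guin_oudom]. *)
have := eq_linear_D_monomial linear_tree_to_forest linear_graftl linear_graftr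
  linear_graft_forestl linear_graft_forestr span_tvec span_monom graft_forest1
  graft_forest_cons (tvec t).
apply; [exact: linext_is_linear | exact: linear_guin_oudom | | reflexivity].
move=> v szv; rewrite monomE [LHS]forest_extE [RHS]guin_oudom_fvec.
by rewrite (perm_size (perm_forest_seq v)) szv.
Qed.

Lemma guin_oudomM (x y : treespan) (W : forestspan) :
  guin_oudom (iota x * W) y = graft x (guin_oudom W y) - guin_oudom (graft_forest x W) y.
Proof.
exact: (GO_mul linear_tree_to_forest linear_BplusL linear_graftl linear_graftr
  linear_graft_forestl linear_graft_forestr span_tvec span_monom graft_forest1
  graft_forest_cons graft_Bplus tree_ind_monom (linear_guin_oudom y)
  (guin_oudom_monom y)).
Qed.

End Grafting.

(** * Symmetrization over the order of the arguments *)

(** The factor hit by [D] is marked by a test on its index, as in [graft_at]; distinct indices make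
    the test select a single factor. *)
Lemma derivation_prod (F : comNzRingType) (D : F -> F) (I : eqType) (r : seq I) (g : I -> F) :
    (forall Y Z, D (Y * Z) = D Y * Z + Y * D Z) -> uniq r ->
  D (\prod_(i <- r) g i) =
  \sum_(b <- r) \prod_(i <- r) (if i == b then D (g i) else g i).
Proof.
move=> DM; elim: r => [|j r IH] /=.
  rewrite !big_nil => _; have := DM 1 1; rewrite !mulr1 !mul1r => /esym/eqP.
  by rewrite -subr_eq0 addrK => /eqP.
case/andP=> jNr /IH{}IH; rewrite !big_cons DM eqxx; congr (_ * _ + _).
  by apply: eq_big_seq => i ir; case: eqP ir => // ->; rewrite (negPf jNr).
rewrite IH mulr_sumr; apply: eq_big_seq => b br.
by rewrite big_cons; case: eqP br => // <-; rewrite (negPf jNr).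
Qed.

Lemma sum_lift_perm (V : zmodType) (n : nat) (i0 : 'I_n.+1) (f : 'S_n.+1 -> V) :
  \sum_p f p = \sum_a \sum_(q : 'S_n) f (lift_perm i0 a q).
Proof.
rewrite (partition_big (fun p : 'S_n.+1 => p i0) xpredT) //=.
apply: eq_bigr => a _; rewrite (reindex (lift_perm i0 a)) /=.
  by apply: eq_bigl => q; rewrite lift_perm_id eqxx.
(* [ulsf i s] is the map induced by [s] from the complement of [i] to that of [s i], both
   renumbered. *)
pose ulsf i (s : 'S_n.+1) k := odflt k (unlift (s i) (s (lift i k))).
have ulsfK i (s : 'S_n.+1) k: lift (s i) (ulsf i s k) = s (lift i k).
  rewrite /ulsf; have:= neq_lift i k.
  by rewrite -(can_eq (permK s)) => /unlift_some[] ? ? ->.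
have inj_ulsf: injective (ulsf i0 _).
  move=> s; apply: can_inj (ulsf (s i0) s^-1%g) _ => k'.
  by rewrite {1}/ulsf ulsfK !permK liftK.
exists (fun s => perm (inj_ulsf s)) => [s _ | s].
  by apply/permP=> k'; rewrite permE /ulsf lift_perm_lift lift_perm_id liftK.
move/(s _ =P _) => si0; apply/permP=> k.
case: (unliftP i0 k) => [k'|] ->; rewrite ?lift_perm_id //.
by rewrite lift_perm_lift -si0 permE ulsfK.
Qed.

Section Symmetrization.
Variables (T : zmodType) (gr : T -> T -> T).

Definition graft_at k (a : 'I_k.+1) (b : 'I_k) (f : 'I_k.+1 -> T) (j : 'I_k) : T :=
  if j == b then gr (f a) (f (lift a j)) else f (lift a j).

Variable y : T.

(** Since [lift ord0 m] is position [m + 1], the correction terms graft each argument on its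
    predecessor, instead of the extracted one on all others. The link with the Guin-Oudom recursion
    appears after symmetrization. *)
Fixpoint adjacent_graft k : ('I_k -> T) -> T :=
  if k is k'.+1 return ('I_k -> T) -> T then
    fun f => gr (f ord_max) (adjacent_graft (fun i => f (lift ord_max i)))
             - \sum_(m < k') adjacent_graft (graft_at (lift ord0 m) m f)
  else fun=> y.

Lemma eq_graft_at k a b (f g : 'I_k.+1 -> T) : f =1 g -> graft_at a b f =1 graft_at a b g.
Proof. by move=> fg j; rewrite /graft_at !fg. Qed.

Lemma eq_adjacent_graft k (f g : 'I_k -> T) :
  f =1 g -> adjacent_graft f = adjacent_graft g.
Proof.
elim: k => [|k IH] // in f g * => fg /=.
rewrite fg; congr (gr _ _ - _); first by apply: IH => i; apply: fg.
by apply: eq_bigr => m _; apply: IH; apply: eq_graft_at.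
Qed.

(** Position [m + 1] carries argument [a] and position [m] the one numbered [q m] among the others,
    so a permuted adjacent pair is an arbitrary pair. *)
Lemma graft_at_lift_perm k (a : 'I_k.+1) (m : 'I_k) (q : 'S_k) (f : 'I_k.+1 -> T) :
  graft_at (lift ord0 m) m (f \o lift_perm (lift ord0 m) a q) =1 graft_at a (q m) f \o q.
Proof.
by move=> j; rewrite /graft_at /= lift_perm_id lift_perm_lift (inj_eq perm_inj).
Qed.

Hypothesis grD : forall x, {morph gr x : u v / u + v}.
Variable F : forall k, ('I_k -> T) -> T.
Hypothesis F0 : forall f, F (k := 0) f = y.
Hypothesis F_rec : forall k (f : 'I_k.+1 -> T) a,
  F f = gr (f a) (F (fun i => f (lift a i))) - \sum_b F (graft_at a b f).

Lemma gr_Mn x u n : gr x (u *+ n) = gr x u *+ n.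
Proof.
have gr0 : gr x 0 = 0 by apply: (addrI (gr x 0)); rewrite -grD !addr0.
by elim: n => [|n IH]; rewrite ?mulr0n // !mulrS grD IH.
Qed.

Lemma gr_sum x (J : finType) (u : J -> T) : gr x (\sum_i u i) = \sum_i gr x (u i).
Proof.
by apply: big_morph => //; apply: (addrI (gr x 0)); rewrite -grD !addr0.
Qed.

(* Summing over all orders, the term grafting the last argument on position [m] can
   be rearranged so that the pair of adjacent arguments is arbitrary. *)
Lemma sum_perm_adjacent_graft k (f : 'I_k -> T) :
  \sum_(p : 'S_k) adjacent_graft (f \o p) = F f *+ k`!.
Proof.
elim: k f => [|k IH] f.
  by rewrite (eq_bigr (fun=> y)) // sumr_const F0 card_Sn.
rewrite /= sumrB.
have -> : \sum_(p : 'S_k.+1) gr (f (p ord_max)) (adjacent_graft (fun i => f (p (lift ord_max i))))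
    = (\sum_a gr (f a) (F (fun i => f (lift a i)))) *+ k`!.
  rewrite (sum_lift_perm ord_max) -sumrMnl; apply: eq_bigr => a _.
  rewrite -gr_Mn -IH gr_sum; apply: eq_bigr => q _.
  rewrite lift_perm_id; congr (gr _ _).
  by apply: eq_adjacent_graft => i /=; rewrite lift_perm_lift.
have -> : \sum_(p : 'S_k.+1) \sum_(m < k) adjacent_graft (graft_at (lift ord0 m) m (f \o p))
    = (\sum_a \sum_b F (graft_at a b f)) *+ k`!.
  transitivity (\sum_(m < k) \sum_a \sum_(q : 'S_k) adjacent_graft (graft_at a (q m) f \o q)).
    rewrite exchange_big; apply: eq_bigr => m _.
    rewrite (sum_lift_perm (lift ord0 m)); apply: eq_bigr => a _.
    by apply: eq_bigr => q _; apply: eq_adjacent_graft; apply: graft_at_lift_perm.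
  rewrite exchange_big -sumrMnl; apply: eq_bigr => a _.
  rewrite exchange_big -sumrMnl /=.
  (* For fixed [q], the position [q m] takes every value [b] exactly once. *)
  rewrite (eq_bigr (fun q : 'S_k => \sum_b adjacent_graft (graft_at a b f \o q))).
    by rewrite exchange_big; apply: eq_bigr => b _; rewrite IH.
  by move=> q _; rewrite [RHS](reindex_inj (@perm_inj _ q)).
(* By [F_rec] each of the [k + 1] choices of [a] contributes the same [F f]. *)
rewrite -mulrnBl -sumrB (eq_bigr (fun=> F f)) => [|a _].
  by rewrite sumr_const card_ord -mulrnA factS.
by rewrite -F_rec.
Qed.

End Symmetrization.

(** * Labelled binary trees: contractions against insertions *)

Fixpoint btree_bind (g : nat -> btree) (r : btree) : btree :=
  match r with
  | BLeaf a => g a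
  | BNode r1 r2 => BNode (btree_bind g r1) (btree_bind g r2)
  end.

Fixpoint right_leaf (r : btree) : nat :=
  match r with BLeaf a => a | BNode _ r2 => right_leaf r2 end.

Fixpoint btree_eval (T : Type) (gr : T -> T -> T) (x : nat -> T) (r : btree) : T :=
  match r with
  | BLeaf a => x a
  | BNode r1 r2 => gr (btree_eval gr x r1) (btree_eval gr x r2)
  end.

Lemma btree_eval_bind (T : Type) (gr : T -> T -> T) x g r :
  btree_eval gr x (btree_bind g r) = btree_eval gr (fun a => btree_eval gr x (g a)) r.
Proof. by elim: r => //= r1 -> r2 ->. Qed.

Lemma leaves_bind g r : leaves (btree_bind g r) = flatten [seq leaves (g a) | a <- leaves r].
Proof. by elim: r => [a|r1 IH1 r2 IH2] /=; rewrite ?cats0 // map_cat flatten_cat IH1 IH2. Qed.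

Lemma leaves_left_leaf r : leaves r = left_leaf r :: behead (leaves r).
Proof. by elim: r => //= r1 -> r2 _. Qed.

Lemma left_leaf_bind g r : left_leaf (btree_bind g r) = left_leaf (g (left_leaf r)).
Proof. by elim: r. Qed.

Lemma right_leaf_bind g r : right_leaf (btree_bind g r) = right_leaf (g (right_leaf r)).
Proof. by elim: r. Qed.

Lemma mL_bind g r : mL (btree_bind g r) = (mL r + mL (g (left_leaf r)))%N.
Proof. by elim: r => //= r1 -> r2 _. Qed.

Lemma mR_bind g r : mR (btree_bind g r) = (mR r + mR (g (right_leaf r)))%N.
Proof. by elim: r => //= r1 _ r2 ->. Qed.

Lemma recomb_left_comb r : recomb (BLeaf (left_leaf r)) (left_comb r) = r.
Proof. by elim: r => //= r1 -> r2 _. Qed.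

Lemma insertion1 j r : insertion j 1 r = BNode (BLeaf j) r.
Proof. by rewrite /insertion /Ppart /= drop0 take0 recomb_left_comb. Qed.

Lemma insertionS j l r1 r2 :
  insertion j l.+2 (BNode r1 r2) = BNode (insertion j l.+1 r1) r2.
Proof. by []. Qed.

(* Inverse to the contraction of the cherry with leaves [m.+1] and [m]. *)
Definition expand_leaf (m a : nat) : btree :=
  if (a < m)%N then BLeaf a
  else if a == m then BNode (BLeaf m.+1) (BLeaf m) else BLeaf a.+1.
Definition expand (m : nat) : btree -> btree := btree_bind (expand_leaf m).

Lemma expand_leaf_gt m a : (m < a)%N -> expand_leaf m a = BLeaf a.+1.
Proof. by move=> ma; rewrite /expand_leaf ltnNge (ltnW ma) gtn_eqF. Qed.

(** The inserted leaf exceeds [m] and is only renumbered; positions on the left spine are counted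
    from the root, so opening a leaf does not move them. *)
Lemma expand_insertion m k l r : (m <= k)%N -> (0 < l <= (mL r).+1)%N ->
  expand m (insertion k.+1 l r) = insertion k.+2 l (expand m r).
Proof.
move=> mk; have expS : expand_leaf m k.+1 = BLeaf k.+2.
  by rewrite expand_leaf_gt.
elim: r l => [a|r1 IH1 r2 _] [|[|l]] // lr.
- by rewrite !insertion1 /expand /= expS.
- by rewrite !insertion1 /expand /= expS.
rewrite insertionS -[expand m (BNode _ _)]/(BNode (expand m _) (expand m r2)) IH1 //.
Qed.

Lemma expand_id k r : all (gtn k) (leaves r) -> expand k r = r.
Proof.
elim: r => [a|r1 IH1 r2 IH2] /=; first by
  rewrite andbT => ak; rewrite /expand /= /expand_leaf (ak : (a < k)%N).
rewrite all_cat => /andP[/IH1 e1 /IH2 e2].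
by rewrite -[LHS]/(BNode (expand k r1) (expand k r2)) e1 e2.
Qed.

(** The two constructions meet here: all other leaves are below [k] and stay fixed, and opening the
    leftmost one creates the lowest vertex of the left spine. *)
Lemma expand_left_leaf k r : left_leaf r = k -> all (gtn k) (behead (leaves r)) ->
  expand k r = insertion k.+1 (mL r).+1 r.
Proof.
elim: r => [a /= -> _|r1 IH1 r2 _ /= r1k].
  by rewrite insertion1 /expand /= /expand_leaf ltnn eqxx.
rewrite leaves_left_leaf /= all_cat => /andP[lt1 lt2].
by rewrite insertionS -(IH1 r1k lt1) -[in RHS](expand_id lt2).
Qed.

Section Collapse.
Variable V : zmodType.
Implicit Types (h : btree -> seq nat -> V) (r : btree) (i : seq nat).

(* A configuration with [k] inner vertices is a tree [r] whose leaves read 0, .., k from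
   right to left, with the list [i] of the labels of its left spine, from the root. *)
Definition collapse_step k h r i : V :=
  h (BNode (BLeaf k.+1) r) [:: k] +
  \sum_(1 <= m < k.+1) h (expand m r) (if m == k then rcons i k else i).

(** The last step is absorbed into [h], so that the sum over all configurations reached in [k] steps
    is taken without listing them. *)
Fixpoint collapse k h : V :=
  if k is k'.+1 then collapse k' (collapse_step k' h) else h (BLeaf 0) [::].

(** The new vertex, with a label [j] above the root label, becomes the root or is placed just above
    the first spine vertex with label at least [j]. The spine below it moves into its right subtree
    and its labels are forgotten. *)
Definition insert_step k h r i : V :=
  \sum_(0 <= j < k.+1 | (head 0 i < j)%N)
    (h (BNode (BLeaf k.+1) r) [:: j] +
     h (insertion k.+1 (find (leq j) i).+1 r) (rcons (take (find (leq j) i) i) j)).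

(** The start is the cherry, with one inner vertex: on a single leaf [insert_step] is an empty
    sum. *)
Fixpoint insert k h : V :=
  if k is k'.+1 then insert k' (insert_step k h)
  else h (BNode (BLeaf 1) (BLeaf 0)) [:: 0%N].

(** Invariants along [collapse]: functions need to be compared only on such configurations.
    [state_mR] makes the truncated subtraction in the signs exact. *)
Record state k r i : Prop := State {
  state_size : size i = mL r;
  state_pos : (0 < k)%N -> (0 < size i)%N;
  state_lt : all (gtn k) i;
  state_left : left_leaf r = k;
  state_leaves : all (gtn k) (behead (leaves r));
  state_right : right_leaf r = 0%N;
  state_mR : (mR r <= k)%N
}.

Lemma state0 : state 0 (BLeaf 0) [::].
Proof. by []. Qed.

Lemma state_node k r i : state k r i -> state k.+1 (BNode (BLeaf k.+1) r) [:: k].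
Proof.
case=> _ _ _ r_k r_lt r_0 r_R; split=> //=; first by rewrite ltnSn.
rewrite leaves_left_leaf /= r_k ltnSn /=.
by apply: sub_all r_lt => a /= /ltnW.
Qed.

Lemma state_expand k m r i : state k r i -> (1 <= m < k.+1)%N ->
  state k.+1 (expand m r) (if m == k then rcons i k else i).
Proof.
case=> sz_i i_gt0 i_lt r_k r_lt r_0 r_R /andP[m_gt0]; rewrite ltnS => m_k.
(* The leftmost leaf is [k]: it is opened for [m = k] and only renumbered otherwise. *)
have exp_left : expand_leaf m k = if m == k then BNode (BLeaf k.+1) (BLeaf k) else BLeaf k.+1.
  by rewrite /expand_leaf ltnNge m_k /= eq_sym; case: eqP => // ->.
split.
- rewrite mL_bind r_k exp_left; case: eqP => _ /=; rewrite ?size_rcons sz_i ?addn0 //.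
  by rewrite addn1.
- by move=> _; case: ifP; rewrite ?size_rcons // => _; apply: i_gt0; apply: leq_trans m_k.
- have i_ltS : all (gtn k.+1) i by apply: sub_all i_lt => a /= /ltnW.
  by case: ifP => // _; rewrite all_rcons /= ltnSn.
- by rewrite left_leaf_bind r_k exp_left; case: ifP.
- rewrite leaves_bind leaves_left_leaf /= r_k exp_left.
  have lt_flat s : all (gtn k) s -> all (gtn k.+1) (flatten [seq leaves (expand_leaf m a) | a <- s]).
    elim: s => //= a s IH /andP[lt_ak /IH]; rewrite all_cat => ->.
    rewrite andbT /expand_leaf; case: ltnP => _ /=.
      by rewrite andbT ltnS (ltnW lt_ak).
    case: eqP => [<-|_] /=; rewrite !andbT !ltnS; last exact: lt_ak.
    by apply/andP; split; [exact: lt_ak|exact: ltnW].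
  by case: ifP => _ /=; rewrite ?ltnSn; apply: lt_flat.
- by rewrite right_leaf_bind r_0 /expand_leaf m_gt0.
- by rewrite mR_bind r_0 /expand_leaf m_gt0 addn0 ltnW.
Qed.

Lemma eq_collapse_state k h h' : (forall r i, state k r i -> h r i = h' r i) ->
  collapse k h = collapse k h'.
Proof.
elim: k => [|k IH] /= in h h' *; first by apply; apply: state0.
move=> hh'; apply: IH => r i st; rewrite /collapse_step hh'; last exact: state_node st.
by congr (_ + _); apply: eq_big_nat => m mk; rewrite hh' //; apply: state_expand.
Qed.

Lemma collapseD k h h' : collapse k (fun r i => h r i + h' r i) = collapse k h + collapse k h'.
Proof.
elim: k => [|k IH] //= in h h' *; rewrite -IH; apply: eq_collapse_state => r i _.
by rewrite /collapse_step big_split addrACA.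
Qed.

(* The last contraction and the removal of the leftmost leaf concern the same vertex
   exactly when this vertex has the top position [k]: both steps have that part in
   common, and their remaining parts commute. *)
Definition top_step k h r i : V :=
  h (BNode (BLeaf k.+1) r) [:: k] + h (insertion k.+1 (size i).+1 r) (rcons i k).

Definition collapse_below k h r i : V := \sum_(1 <= m < k) h (expand m r) i.

Definition insert_below k h r i : V :=
  \sum_(0 <= j < k | (head 0 i < j)%N)
    (h (BNode (BLeaf k.+1) r) [:: j] +
     h (insertion k.+1 (find (leq j) i).+1 r) (rcons (take (find (leq j) i) i) j)).

Lemma collapse_step_split k h r i : (0 < k)%N -> state k r i ->
  collapse_step k h r i = collapse_below k h r i + top_step k h r i.
Proof.
move=> k_gt0 st; rewrite /collapse_step /collapse_below /top_step.
rewrite big_nat_recr //= eqxx addrCA; congr (_ + (_ + _)).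
  by apply: eq_big_nat => m /andP[_ mk]; rewrite ltn_eqF.
by rewrite expand_left_leaf ?(state_left st) ?(state_leaves st) // (state_size st).
Qed.

Lemma insert_step_split k h r i : (0 < k)%N -> state k r i ->
  insert_step k h r i = insert_below k h r i + top_step k h r i.
Proof.
move=> k_gt0 [_ /(_ k_gt0) i_gt0 i_lt _ _ _ _].
rewrite /insert_step /insert_below /top_step big_mkcond big_nat_recr //= -big_mkcond.
have -> : (head 0 i < k)%N by case: i i_gt0 i_lt => //= a i _ /andP[].
(* All labels of [i] are below [k], so the label [k] goes to the bottom of the left spine. *)
suff -> : find (leq k) i = size i by rewrite take_size.
by apply: hasNfind; rewrite -all_predC; apply: sub_all i_lt => a /=; rewrite ltnNge.
Qed.

Lemma step_comm k h r i : (0 < k)%N -> state k r i ->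
  collapse_step k (insert_below k.+1 h) r i = insert_step k (collapse_below k.+1 h) r i.
Proof.
move=> k_gt0 [sz_i /(_ k_gt0) i_gt0 _ _ _ _ _].
(* After a root with label [k] is added, no [j] below [k.+1] exceeds the root label. *)
rewrite /collapse_step {1}/insert_below big_nat_cond big1 ?add0r; last first.
  by move=> j /andP[/andP[_ jk]] /=; rewrite ltnNge -ltnS jk.
rewrite /insert_step /collapse_below /insert_below.
under [RHS]eq_bigr => j _ do rewrite -big_split.
rewrite exchange_big_nat /=.
apply: eq_big_nat => m /andP[_ mk].
have -> : head 0%N (if m == k then rcons i k else i) = head 0%N i.
  by case: ifP => // _; rewrite -cats1; case: i i_gt0 {sz_i}.
rewrite [LHS]big_nat_cond [RHS]big_nat_cond; apply: eq_bigr => j /andP[/andP[_ jk] _].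
(* As [j <= k], a label [k] appended to [i] can only be found at the position [size i], which
   already encodes a failed search in [i]. *)
have find_i : find (leq j) (if m == k then rcons i k else i) = find (leq j) i.
  case: ifP => // _; rewrite -cats1 find_cat; case: ifP => // hasN.
  by rewrite /= -ltnS jk addn0 hasNfind // hasN.
have take_i : take (find (leq j) i) (if m == k then rcons i k else i) = take (find (leq j) i) i.
  by case: ifP => // _; rewrite -cats1 takel_cat // find_size.
rewrite find_i take_i; congr (h _ _ + h _ _).
  by rewrite /expand /= expand_leaf_gt.
by rewrite expand_insertion //= ltnS -sz_i find_size.
Qed.

(** Once [top_step] cancels, [step_comm] exchanges the remaining parts one level lower. The
    induction hypothesis serves at two consecutive sizes, hence the strong induction. *)
Theorem insert_collapse k h : insert k h = collapse k.+1 h.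
Proof.
elim/ltn_ind: k h => -[|k] IH h; first by rewrite /= /collapse_step /= big_geq ?addr0.
rewrite -[insert _ _]/(insert k (insert_step k.+1 h)) IH //.
rewrite -[collapse k.+2 h]/(collapse k.+1 (collapse_step k.+1 h)).
rewrite (eq_collapse_state (fun r i => @insert_step_split k.+1 h r i (ltn0Sn k))).
rewrite (eq_collapse_state (fun r i => @collapse_step_split k.+1 h r i (ltn0Sn k))) !collapseD.
congr (_ + _); case: k IH => [|k] IH.
  rewrite /= /collapse_step !(@big_geq _ _ _ 1) // !addr0 /insert_below /collapse_below.
  by rewrite big_mkcond big_nat1 big_geq.
rewrite -[LHS]/(collapse k.+1 (collapse_step k.+1 (insert_below k.+2 h))).
rewrite (eq_collapse_state (fun r i => @step_comm k.+1 h r i (ltn0Sn k))) -IH //.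
by rewrite -[LHS]/(insert k.+1 (collapse_below k.+2 h)) IH.
Qed.

End Collapse.

(** * Binary trees with a given leaf word *)

Section CollapseMorphisms.

Lemma collapse_morph (V W : zmodType) (phi : V -> W) k (h : btree -> seq nat -> V) :
    {morph phi : x y / x + y} ->
  phi (collapse k h) = collapse k (fun r i => phi (h r i)).
Proof.
move=> phiD; elim: k => [|k IH] //= in h *; rewrite IH; apply: eq_collapse_state => r i _.
rewrite phiD; congr (_ + _); apply: (big_morph phi) => //.
by apply: (addrI (phi 0)); rewrite -phiD !addr0.
Qed.

Lemma collapse_sum (V : zmodType) k (I : Type) (s : seq I) (h : I -> btree -> seq nat -> V) :
  collapse k (fun r i => \sum_(m <- s) h m r i) = \sum_(m <- s) collapse k (h m).
Proof.
elim: s => [|m s IH].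
  rewrite big_nil; apply: (addrI (collapse k (fun r i => \sum_(m <- [::]) h m r i))).
  rewrite addr0 -collapseD; apply: eq_collapse_state => r i _.
  by rewrite big_nil addr0.
by rewrite big_cons -IH -collapseD; apply: eq_collapse_state => r i _; rewrite big_cons.
Qed.

Variables (R : fieldType) (T : lmodType R) (gr : T -> T -> T).
Hypothesis linear_gr : forall x, linear (gr x).

(** Adding a root raises [mR] by one, while opening a leaf other than [0] keeps it: the exponent
    counts the openings among the [k] steps. *)
Definition signed_eval k (x : nat -> T) (r : btree) (i : seq nat) : T :=
  (-1) ^+ (k - mR r) *: btree_eval gr x r.

Lemma adjacent_graft_collapse k (x : nat -> T) :
  adjacent_graft gr (x 0%N) (fun i : 'I_k => x i.+1) = collapse k (signed_eval k x).
Proof.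
elim: k x => [|k IH] x; first by rewrite /= /signed_eval scale1r.
rewrite [LHS]/= (eq_adjacent_graft gr _ (g := fun i : 'I_k => x i.+1)); last first.
  by move=> i; rewrite /= /bump leqNgt ltn_ord.
rewrite IH (collapse_morph _ _ (linD (linear_gr _))).
(* The argument at position [m] is [x m.+1]; grafting its successor on it amounts to opening the
   leaf [m.+1], and [x 0] is unaffected. *)
pose xm m a := btree_eval gr x (expand_leaf m.+1 a).
rewrite (eq_bigr (fun m : 'I_k => collapse k (signed_eval k (xm m)))) => [|m _]; last first.
  rewrite -IH; apply: eq_adjacent_graft => j.
  rewrite /graft_at /xm /expand_leaf -val_eqE /= /bump /= !ltnS eqSS !add1n.
  by case: (ltngtP j m) => [_|_|->].
rewrite -(big_mkord xpredT (fun m => collapse k (signed_eval k (xm m)))) -sumrN.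
under eq_bigr => m _ do rewrite (collapse_morph _ _ (@opprD T)).
rewrite -collapse_sum -collapseD; apply: eq_collapse_state => r i st.
rewrite /collapse_step /signed_eval /= subSS; congr (_ + _).
  have := linear_gr (x k.+1) ((-1) ^+ (k - mR r)) (btree_eval gr x r) 0.
  by rewrite addr0 (lin0 (linear_gr _)) addr0.
rewrite big_add1 /=; apply: eq_bigr => m _.
rewrite mR_bind (state_right st) /= addn0 subSn ?(state_mR st) // exprS mulN1r scaleNr.
by rewrite btree_eval_bind.
Qed.

End CollapseMorphisms.

Section Enumeration.

Lemma leaves_eq1 r a : (r == BLeaf a) = (leaves r == [:: a]).
Proof.
apply/eqP/eqP => [-> //|]; case: r => [c [->] //|r1 r2] /(congr1 size) /=.
by rewrite size_cat (leaves_left_leaf r1) (leaves_left_leaf r2) /= addnS.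
Qed.

Lemma size_take_drop n (w : seq nat) i : (size w <= n.+1)%N -> i \in iota 1 (size w).-1 ->
  (size (take i w) <= n)%N /\ (size (drop i w) <= n)%N.
Proof.
case: w => // a w; rewrite mem_iota add1n /= !ltnS => w_n /andP[i_gt0 i_w].
rewrite size_drop; split; last first.
  by rewrite /= leq_subLR (leq_ltn_trans w_n) // -addn1 addnC leq_add2r.
by rewrite size_takel ?(leq_trans i_w) // leqW.
Qed.

Lemma mem_btree_enum n w r : (size w <= n)%N -> (r \in btree_enum n w) = (leaves r == w).
Proof.
have leavesN0 s : (leaves s == [::]) = false by rewrite leaves_left_leaf.
elim: n w r => [|n IH] [|a [|b w]] r // sz_w.
  by rewrite inE leaves_eq1.
set W := a :: b :: w.
rewrite -[btree_enum _ _]/(flatten [seq [seq BNode r1 r2 | r1 <- btree_enum n (take i W),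
    r2 <- btree_enum n (drop i W)] | i <- iota 1 (size W).-1]).
apply/idP/idP.
  case/flatten_mapP => i iW; have [szt szd] := size_take_drop sz_w iW.
  case/allpairsP => -[r1 r2] /= []; rewrite !IH // => /eqP e1 /eqP e2 ->.
  by rewrite /= e1 e2 cat_take_drop.
case: r => [c /eqP //|r1 r2 /eqP eW].
have sz1 : (0 < size (leaves r1))%N by rewrite leaves_left_leaf.
have sz2 : (0 < size (leaves r2))%N by rewrite leaves_left_leaf.
apply/flatten_mapP; exists (size (leaves r1)).
  rewrite mem_iota add1n prednK // -eW size_cat sz1.
  by rewrite -[X in (X < _)%N]addn0 ltn_add2l.
apply/allpairsP; exists (r1, r2) => /=.
have sz12 : (size (leaves r1) + size (leaves r2) <= n.+1)%N by rewrite -size_cat [_ ++ _]eW.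
rewrite -/W -eW take_size_cat // drop_size_cat // !IH ?eqxx //.
- by rewrite -ltnS (leq_trans _ sz12) // -[X in (X < _)%N]add0n ltn_add2r.
- by rewrite -ltnS (leq_trans _ sz12) // -[X in (X < _)%N]addn0 ltn_add2l.
Qed.

Lemma uniq_flatten_map (I S : eqType) (F : I -> seq S) (s : seq I) (key : S -> I) :
    uniq s -> (forall i, i \in s -> uniq (F i)) ->
    (forall i x, i \in s -> x \in F i -> key x = i) ->
  uniq (flatten [seq F i | i <- s]).
Proof.
elim: s => //= i s IH /andP[iNs s_uniq] F_uniq keyF.
rewrite cat_uniq F_uniq ?mem_head // IH //=; first last.
- by move=> j x js; apply: keyF; rewrite inE js orbT.
- by move=> j js; apply: F_uniq; rewrite inE js orbT.
rewrite andbT; apply/hasPn => x /flatten_mapP[j js xj]; apply: contra iNs => xi.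
by rewrite -(keyF i x) ?mem_head // (keyF j x) // inE js orbT.
Qed.

Lemma uniq_btree_enum n w : (size w <= n)%N -> uniq (btree_enum n w).
Proof.
elim: n w => [|n IH] [|a [|b w]] // sz_w; set W := a :: b :: w.
(* The cutting position is recovered as the number of leaves of the left subtree. *)
apply: (uniq_flatten_map (key := fun r => if r is BNode r1 _ then size (leaves r1) else 0%N)).
- exact: iota_uniq.
- move=> i /(size_take_drop sz_w)[sz1 sz2]; apply: allpairs_uniq; [exact: IH|exact: IH|].
  by move=> [r1 r2] [r3 r4] _ _ /= [-> ->].
move=> i r iW /allpairsP[[r1 r2] /= []]; have [sz1 sz2] := size_take_drop sz_w iW.
rewrite !mem_btree_enum // => /eqP e1 _ ->; rewrite e1 size_takel //.
by move: iW; rewrite mem_iota add1n prednK // => /andP[_ /ltnW].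
Qed.

Lemma mem_btrees I r : (r \in btrees I) = (leaves r == rev (0%N :: I)).
Proof. by rewrite mem_btree_enum // size_rev. Qed.

Lemma uniq_btrees I : uniq (btrees I).
Proof. by rewrite uniq_btree_enum // size_rev. Qed.

Lemma Vminus_node r1 r2 :
  Vminus (BNode r1 r2) = if r1 is BLeaf _ then r2 else BNode (Vminus r1) r2.
Proof. by case: r1. Qed.

Lemma insertion_node a l r : exists r1 r2, insertion a l r = BNode r1 r2.
Proof.
case: l => [|[|l]].
- by rewrite /insertion take0; do 2!eexists.
- by rewrite insertion1; do 2!eexists.
by case: r => [b|r1 r2]; [rewrite /insertion|]; do 2!eexists.
Qed.

Lemma mL_insertion a l r : (0 < l <= (mL r).+1)%N -> mL (insertion a l r) = l.
Proof.
elim: r l => [b|r1 IH r2 _] [|[|l]] // lr; rewrite ?insertion1 //.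
by rewrite insertionS -[LHS]/(mL (insertion a l.+1 r1)).+1 IH.
Qed.

Lemma leaves_insertion a l r : (0 < l <= (mL r).+1)%N ->
  leaves (insertion a l r) = a :: leaves r.
Proof.
elim: r l => [b|r1 IH r2 _] [|[|l]] // lr; rewrite ?insertion1 //.
by rewrite insertionS -[LHS]/(leaves (insertion a l.+1 r1) ++ leaves r2) IH.
Qed.

Lemma Vminus_insertion a l r : (0 < l <= (mL r).+1)%N -> Vminus (insertion a l r) = r.
Proof.
elim: r l => [b|r1 IH r2 _] [|[|l]] // lr; rewrite ?insertion1 //.
rewrite insertionS Vminus_node; have := IH l.+1 lr.
by have [r3 [r4 ->]] := insertion_node a l.+1 r1 => ->.
Qed.

Lemma insertion_Vminus r : (0 < mL r)%N ->
  (mL r <= (mL (Vminus r)).+1)%N /\ insertion (left_leaf r) (mL r) (Vminus r) = r.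
Proof.
elim: r => // -[a _ r2 _ _|r3 r4 IH r2 _ _]; first by rewrite /= insertion1.
rewrite Vminus_node -[mL (BNode _ r2)]/(mL (BNode r3 r4)).+1.
have [|le_mL eq_r] := IH; first by [].
split; first by rewrite ltnS.
by rewrite [mL _]/= insertionS -[(mL r3).+1]/(mL (BNode r3 r4)) eq_r.
Qed.

(** The word is read from right to left, so [a] is the leftmost leaf; a tree is determined by that
    leaf, its depth [mL] and the image under [Vminus]. *)
Lemma btrees_rcons I a : perm_eq (btrees (rcons I a))
  [seq insertion a l r | r <- btrees I, l <- iota 1 (mL r).+1].
Proof.
have l_range r l : (l \in iota 1 (mL r).+1) = (0 < l <= (mL r).+1)%N.
  by rewrite mem_iota add1n ltnS.
have rev_rcons0 : rev (0%N :: rcons I a) = a :: rev (0%N :: I).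
  by rewrite -rcons_cons rev_rcons.
apply: uniq_perm; first exact: uniq_btrees.
  apply: allpairs_uniq_dep => [|r _|[r l] [r' l']]; [exact: uniq_btrees|exact: iota_uniq|].
  case/allpairsPdep=> [r1 [l1 [_ l1r1 [-> ->]]]] /allpairsPdep[r2 [l2 [_ l2r2 [-> ->]]]] /= e.
  rewrite !l_range in l1r1 l2r2.
  have := congr1 mL e; rewrite !mL_insertion // => ->.
  by have := congr1 Vminus e; rewrite !Vminus_insertion // => ->.
move=> r; rewrite mem_btrees rev_rcons0; apply/idP/idP => [/eqP r_leaves|].
  have mL_gt0 : (0 < mL r)%N.
    case: r r_leaves => // b [_] /(congr1 size); by rewrite size_rev.
  have [le_mL eq_r] := insertion_Vminus mL_gt0.
  apply/allpairsPdep; exists (Vminus r), (mL r); rewrite l_range mL_gt0 le_mL; split=> //.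
    rewrite mem_btrees; apply/eqP; move: r_leaves.
    by rewrite -{1}eq_r leaves_insertion ?mL_gt0 // => -[_ ->].
  by rewrite -[in LHS]eq_r; move: r_leaves; rewrite leaves_left_leaf => -[->].
case/allpairsPdep=> r1 [l [r1I]]; rewrite l_range => l_r1 ->.
by rewrite leaves_insertion // eqseq_cons eqxx -mem_btrees.
Qed.

End Enumeration.

(** * The multi-indices J *)

(** Plain sequences replace tuples of ordinals, so that index tuples can be cut and concatenated
    without casts. *)
Definition incseqs (l n : nat) : seq (seq nat) :=
  [seq map val (val j) | j : l.-tuple 'I_n <- index_enum _ & increasing j].

Lemma mem_incseqs l n s :
  (s \in incseqs l n) = [&& size s == l, pairwise ltn s & all (gtn n) s].
Proof.
rewrite -sorted_pairwise; last exact: ltn_trans.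
apply/mapP/and3P => [[j]|[/eqP sz_s inc_s lt_s]].
  rewrite mem_filter => /andP[inc_j _] ->; rewrite size_map size_tuple; split=> //.
  by apply/allP => _ /mapP[i _ ->]; apply: ltn_ord.
have sz_t : size (pmap insub s : seq 'I_n) == l.
  by rewrite size_pmap_sub -sz_s -all_count.
have val_t : map val (pmap insub s : seq 'I_n) = s.
  rewrite (pmap_filter (insubK _)); apply/all_filterP; apply: sub_all lt_s => a a_n.
  by rewrite /= insubT.
by exists (Tuple sz_t); rewrite ?mem_filter ?mem_index_enum /increasing /= val_t // inc_s.
Qed.

Lemma uniq_incseqs l n : uniq (incseqs l n).
Proof.
rewrite map_inj_uniq ?filter_uniq ?index_enum_uniq // => j j' e.
by apply/val_inj/(inj_map val_inj).
Qed.

Lemma big_increasing (A : Type) (idx : A) (op : A -> A -> A) l n (F : seq nat -> A) :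
  \big[op/idx]_(j : l.-tuple 'I_n | increasing j) F (map val j) =
  \big[op/idx]_(s <- incseqs l n) F s.
Proof. by rewrite big_map big_filter. Qed.

Arguments big_increasing {A idx op l n} F.

Lemma incseqs1 n : perm_eq (incseqs 1 n) [seq [:: j] | j <- iota 0 n].
Proof.
apply: uniq_perm; [exact: uniq_incseqs|by rewrite map_inj_uniq ?iota_uniq // => a b []|].
move=> s; rewrite mem_incseqs; apply/and3P/mapP => [[]|[j jn ->]].
  case: s => [|j [|]] //= _ _ /andP[jn _]; exists j => //.
  by rewrite mem_iota.
by split; rewrite //= andbT; rewrite mem_iota in jn.
Qed.

Lemma incseqs0 n : incseqs 0 n = [:: [::]].
Proof.
apply: perm_small_eq => //; apply: uniq_perm => [||s]; [exact: uniq_incseqs|by []|].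
by rewrite mem_incseqs inE; case: s.
Qed.

Lemma big_pairs (V : nmodType) (A B : eqType) (s : seq A) (t : seq B) (P : A -> B -> bool)
    (F : A -> B -> V) :
  \sum_(a <- s) \sum_(b <- t | P a b) F a b =
  \sum_(p <- [seq p <- [seq (a, b) | a <- s, b <- t] | P p.1 p.2]) F p.1 p.2.
Proof.
rewrite big_filter [RHS]big_mkcond big_allpairs; apply: eq_bigr => a _.
by rewrite [LHS]big_mkcond.
Qed.

(* The pair [(i, j)] is encoded by inserting [j] into [i] and cutting after [j]. *)
Lemma sum_split_incseqs (V : nmodType) l M k (F : seq nat -> seq nat -> V) :
    (0 < l <= M)%N ->
  \sum_(s <- incseqs l.+1 k.+1)
    \sum_(t <- incseqs (M - l) k | (t == [::]) || (last 0 s <= head 0 t)%N) F s t =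
  \sum_(i <- incseqs M k)
    \sum_(0 <= j < k.+1 | (head 0 i < j)%N && (find (leq j) i == l))
      F (rcons (take l i) j) (drop l i).
Proof.
case/andP=> l_gt0 lM; rewrite !big_pairs.
set phi := fun p : seq nat * nat => (rcons (take l p.1) p.2, drop l p.1).
rewrite [RHS](eq_bigr (fun p => F (phi p).1 (phi p).2)) //.
rewrite -(big_map phi xpredT (fun p => F p.1 p.2)).
apply: perm_big; apply: uniq_perm.
- apply: filter_uniq; apply: allpairs_uniq; try exact: uniq_incseqs.
  by move=> [? ?] [? ?] _ _ [-> ->].
- rewrite map_inj_uniq; last first.
    move=> [i j] [i' j'] [/rcons_inj[e1 ->] e2].
    by rewrite -[i](cat_take_drop l) -[i'](cat_take_drop l) e1 e2.
  apply: filter_uniq; apply: allpairs_uniq; [exact: uniq_incseqs|exact: iota_uniq|].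
  by move=> [? ?] [? ?] _ _ [-> ->].
set L := [seq (i, j) | i <- incseqs M k, j <- index_iota 0 k.+1].
move=> [s t]; rewrite mem_filter; apply/andP/mapP.
  case=> [] cond0 /allpairsP[[s0 t0] /= [s_in t_in [es et]]]; subst s0 t0.
  have {cond0} cond : (t == [::]) || (last 0 s <= head 0 t)%N := cond0.
  move: s_in t_in; rewrite !mem_incseqs.
  case/lastP: s cond => // s j; rewrite last_rcons size_rcons eqSS pairwise_rcons all_rcons.
  move=> cond /and3P[/eqP sz_s /andP[s_lt s_inc] /andP[/= j_k s_k]].
  case/and3P=> /eqP sz_t t_inc t_k.
  (* All of [t] is at least [j] and all of [s] is below it, so the search for [j] in [s ++ t] stops
     right after [s]. *)
  have t_ge : all (leq j) t.
    case: t cond t_inc {sz_t t_k} => //= a t ja /andP[a_lt _]; rewrite ja /=.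
    by apply: sub_all a_lt => b /ltnW; apply: leq_trans.
  have sN : ~~ has (leq j) s.
    by rewrite -all_predC; apply: sub_all s_lt => a /=; rewrite ltnNge.
  exists (s ++ t, j); last by rewrite /phi /= take_size_cat // drop_size_cat.
  rewrite mem_filter; apply/andP; split.
    rewrite [X in _ && X]/= find_cat (negPf sN) -sz_s.
    have -> : find (leq j) t = 0%N.
      by case: t t_ge {cond sz_t t_inc t_k} => //= a t /andP[-> _].
    rewrite addn0 eqxx andbT /=.
    by move: l_gt0; rewrite -sz_s; case: s s_lt {s_inc s_k sN sz_s} => // a s /= /andP[].
  apply/allpairsP; exists (s ++ t, j); split=> //; last by rewrite mem_index_iota.
  rewrite mem_incseqs size_cat sz_s sz_t subnKC // eqxx pairwise_cat s_inc t_inc !andbT /=.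
  rewrite all_cat t_k andbT; apply/andP; split.
    apply/allrelP => a b /(allP s_lt) /= aj /(allP t_ge); exact: leq_trans.
  by apply: sub_all s_lt => a /= aj; apply: leq_trans aj _.
case=> [[i j]]; rewrite mem_filter => /andP[/andP[/= i_j /eqP find_l]].
case/allpairsP=> [[i0 j0] /= [i_in j_k [ei ej]]] [-> ->]; subst i0 j0.
move: i_in j_k; rewrite mem_incseqs mem_index_iota /= => /and3P[/eqP sz_i i_inc i_k] j_k.
have lt_take : all (gtn j) (take l i).
  apply/(all_nthP 0%N) => n; rewrite size_takel ?sz_i // => nl.
  by rewrite nth_take //= ltnNge (@before_find _ 0%N (leq j)) // find_l.
move: (i_inc); rewrite -{1}[i](cat_take_drop l) pairwise_cat => /and3P[_ inc_take inc_drop].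
move: (i_k); rewrite -{1}[i](cat_take_drop l) all_cat => /andP[take_k drop_k].
split.
  rewrite last_rcons; case: eqP => //= /eqP drop_neq0.
  have l_lt : (l < size i)%N by rewrite ltnNge; apply: contra drop_neq0 => /drop_oversize ->.
  rewrite -nth0 nth_drop addn0; have := @nth_find _ 0%N (leq j) i.
  by rewrite find_l has_find find_l; apply.
apply/allpairsP; exists (rcons (take l i) j, drop l i); split=> //=; rewrite mem_incseqs.
  rewrite size_rcons size_takel ?sz_i // eqxx pairwise_rcons all_rcons /= lt_take inc_take /=.
  by rewrite j_k; apply: sub_all take_k => a /ltnW.
by rewrite size_drop sz_i eqxx inc_drop.
Qed.

Section SumJ.
Variable V : zmodType.
Implicit Types (h : btree -> seq nat -> V) (r : btree) (i : seq nat).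

Lemma mulrn_condM (x : V) (b : bool) n : x *+ (b * n) = if b then x *+ n else 0.
Proof. by case: b; rewrite ?mul1n ?mul0n. Qed.

Lemma J_rec1 k r s : J_rec k.+1 r 1 s =
  (\sum_(i <- incseqs (mL r) k.+1) (head 0 i < head 0 s) * J_rec k (Vminus r) (mL r) i)%N.
Proof.
rewrite [LHS]/= (big_increasing (fun i => (nth 0 i 0 < nth 0 s 0) *
  J_rec k (Vminus r) (mL r) i)%N).
by apply: eq_bigr => i _; rewrite !nth0.
Qed.

(** The two remaining clauses of [J_rec] are merged: for [l = mL r] the only [t] is empty and the
    comparison is void. *)
Lemma J_recS k r l s : (0 < l <= mL r)%N -> size s = l.+1 -> J_rec k.+1 r l.+1 s =
  (\sum_(t <- incseqs (mL r - l) k.+1 | (t == [::]) || (last 0 s <= head 0 t))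
      J_rec k (Vminus r) (mL r) (take l s ++ t))%N.
Proof.
case/andP=> l_gt0 l_le sz_s; rewrite [LHS]/= eqSS (gtn_eqF l_gt0).
have -> : last 0%N s = nth 0%N s l by rewrite -nth_last sz_s.
move: l_le; rewrite leq_eqVlt => /predU1P[->|l_lt].
  by rewrite ltnn subnn incseqs0 big_cons big_nil /= addn0 cats0.
rewrite l_lt (big_increasing (fun i => (nth 0 s l <= nth 0 i 0) *
  J_rec k (Vminus r) (mL r) (take l s ++ i))%N) subnSK //.
rewrite [RHS]big_mkcond; apply: eq_big_seq => t.
rewrite mem_incseqs => /and3P[/eqP sz_t _ _]; rewrite nth0.
have -> : (t == [::]) = false.
  by apply/eqP => t0; move: l_lt; rewrite -subn_gt0 -sz_t t0.
by rewrite /=; case: (_ <= _)%N; rewrite ?mul1n ?mul0n.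
Qed.

(** The recursion for [J] is transposed: instead of collecting for each [j] its predecessors [i],
    each [i] is distributed over the tuples it produces. *)
Lemma sum_J_insertion k h r : (0 < mL r)%N -> size (leaves r) = k.+2 ->
  \sum_(1 <= l < (mL r).+2) \sum_(j : l.-tuple 'I_k.+2 | increasing j)
     h (insertion k.+2 l r) (map val j) *+ J r l (map val j) =
  \sum_(i : (mL r).-tuple 'I_k.+1 | increasing i)
     insert_step k.+1 h r (map val i) *+ J (Vminus r) (mL r) (map val i).
Proof.
move=> mL_gt0 sz_r; set M := mL r.
have -> : J r = J_rec k.+1 r by rewrite /J sz_r.
have -> : J (Vminus r) = J_rec k (Vminus r).
  have [le_mL eq_r] := insertion_Vminus mL_gt0.
  move: sz_r; rewrite -{1}eq_r leaves_insertion ?mL_gt0 // => -[sz].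
  by rewrite /J sz.
set J' := J_rec k (Vminus r) M.
rewrite (big_increasing (fun i => insert_step k.+1 h r i *+ J' i)).
under [LHS]eq_bigr => l _ do rewrite (big_increasing
  (fun s => h (insertion k.+2 l r) s *+ J_rec k.+1 r l s)).
rewrite big_ltn // big_add1 [_.+2.-1]/=.
have part1 : \sum_(s <- incseqs 1 k.+2) h (insertion k.+2 1 r) s *+ J_rec k.+1 r 1 s =
    \sum_(i <- incseqs M k.+1) \sum_(0 <= j < k.+2 | (head 0 i < j)%N)
      h (BNode (BLeaf k.+2) r) [:: j] *+ J' i.
  rewrite (perm_big _ (incseqs1 k.+2)) big_map.
  under [RHS]eq_bigr => i _ do rewrite big_mkcond.
  rewrite [RHS]exchange_big /index_iota subn0; apply: eq_bigr => j _.
  rewrite J_rec1 insertion1 -sumrMnr; apply: eq_bigr => i _.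
  by rewrite mulrn_condM.
have part2 : \sum_(1 <= l < M.+1) \sum_(s <- incseqs l.+1 k.+2)
      h (insertion k.+2 l.+1 r) s *+ J_rec k.+1 r l.+1 s =
    \sum_(i <- incseqs M k.+1) \sum_(0 <= j < k.+2 | (head 0 i < j)%N)
      h (insertion k.+2 (find (leq j) i).+1 r) (rcons (take (find (leq j) i) i) j) *+ J' i.
  transitivity (\sum_(1 <= l < M.+1) \sum_(i <- incseqs M k.+1)
      \sum_(0 <= j < k.+2 | (head 0 i < j)%N && (find (leq j) i == l))
        h (insertion k.+2 l.+1 r) (rcons (take l i) j) *+ J' i).
    apply: eq_big_nat => l; rewrite ltnS => lM.
    transitivity (\sum_(s <- incseqs l.+1 k.+2) \sum_(t <- incseqs (M - l) k.+1 |
        (t == [::]) || (last 0 s <= head 0 t)%N)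
          h (insertion k.+2 l.+1 r) s *+ J' (take l s ++ t)).
      apply: eq_big_seq => s; rewrite mem_incseqs => /and3P[/eqP sz_s _ _].
      by rewrite J_recS // -sumrMnr.
    rewrite sum_split_incseqs //; apply: eq_big_seq => i.
    rewrite mem_incseqs => /and3P[/eqP sz_i _ _]; apply: eq_bigr => j _.
    rewrite -cats1 takel_cat ?take_takel ?cat_take_drop //.
    by rewrite size_takel // sz_i; case/andP: lM.
  rewrite exchange_big; apply: eq_big_seq => i; rewrite mem_incseqs => /and3P[/eqP sz_i _ _].
  rewrite (exchange_big_dep (fun j => (head 0 i < j)%N)) /=; last by move=> l j _ /andP[].
  apply: eq_bigr => j i_j; rewrite i_j /=.
  under eq_bigl => l do rewrite eq_sym.
  (* Only [l = find (leq j) i] contributes, and it is positive because the root label is below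
     [j]. *)
  rewrite big_nat1_eq ltnS -sz_i find_size andbT.
  suff -> : (0 < find (leq j) i)%N by [].
  move: mL_gt0; rewrite -/M -sz_i; case: i i_j {sz_i} => //= a i a_j _.
  by rewrite (leqNgt j a) a_j.
rewrite part1 part2 -big_split; apply: eq_bigr => i _ /=.
rewrite -big_split /= -sumrMnl; apply: eq_bigr => j _.
by rewrite mulrnDl.
Qed.

(** By [btrees_rcons] each tree is itself an insertion into a smaller one; [sum_J_insertion] then
    absorbs the last insertion into [h]. *)
Lemma sum_J_insert k h :
  \sum_(r <- btrees (iota 1 k)) \sum_(1 <= l < (mL r).+2)
    \sum_(j : l.-tuple 'I_k.+1 | increasing j)
      h (insertion k.+1 l r) (map val j) *+ J r l (map val j) =
  insert k h.
Proof.
elim: k h => [|k IH] h.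
  rewrite [btrees _]/= big_seq1 big_nat1.
  rewrite (big_increasing (fun s => h (insertion 1 1 (BLeaf 0)) s *+ J (BLeaf 0) 1 s)).
  by rewrite (perm_big _ (incseqs1 1)) big_seq1 insertion1.
rewrite -[insert _ _]/(insert k (insert_step k.+1 h)) -IH.
have -> : iota 1 k.+1 = rcons (iota 1 k) k.+1 by rewrite -[k.+1 in LHS]addn1 iotaD add1n cats1.
rewrite (perm_big _ (btrees_rcons _ _)) big_allpairs_dep; apply: eq_big_seq => r r_in.
have sz_r : size (leaves r) = k.+1.
  by move: r_in; rewrite mem_btrees => /eqP->; rewrite size_rev /= size_iota.
rewrite /index_iota subSS subn0 -/(index_iota 1 (mL r).+2) -[(mL r).+2]/(1 + (mL r).+1)%N.
apply: eq_big_seq => l; rewrite mem_iota add1n ltnS => l_r.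
have mLl := mL_insertion k.+1 l_r.
rewrite sum_J_insertion ?leaves_insertion ?mLl ?Vminus_insertion //= ?sz_r //.
by case/andP: l_r.
Qed.

End SumJ.

(** * The Guin-Oudom product *)

Section GuinOudomGrafting.
Variables (R : fieldType) (d : nat).
Local Notation treespan := (treespan R d).
Local Notation forestspan := (forestspan R d).
Local Notation iota := (@tree_to_forest R d).

Lemma graft_forestM (x : treespan) (Y Z : forestspan) :
  graft_forest x (Y * Z) = graft_forest x Y * Z + Y * graft_forest x Z.
Proof.
exact: (D_mul (linear_graft_forestl (R := R) (d := d)) (linear_graft_forestr (R := R) (d := d))
  (@span_tvec R d) (@span_monom R d) (@graft_forest1 R d) (@graft_forest_cons R d)).
Qed.

Lemma graft_tree_to_forest (x y : treespan) : graft_forest x (iota y) = iota (graft x y).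
Proof.
exact: (D_iota (@linear_tree_to_forest R d) (@linear_graftl R d) (@linear_graftr R d)
  (linear_graft_forestl (R := R) (d := d)) (linear_graft_forestr (R := R) (d := d))
  (@span_tvec R d) (@graft_forest1 R d) (@graft_forest_cons R d)).
Qed.

Variable y : treespan.

Definition guin_oudom_fun k (f : 'I_k -> treespan) : treespan :=
  guin_oudom (\prod_i iota (f i)) y.

Lemma guin_oudom1 : guin_oudom (1 : forestspan) y = y.
Proof.
rewrite -fvec1 guin_oudom_fvec.
have -> : (mone : forest d) = forest_of [::] by rewrite /forest_of big_nil.
by rewrite (perm_size (perm_forest_seq [::])).
Qed.

Lemma guin_oudom_fun0 (f : 'I_0 -> treespan) : guin_oudom_fun f = y.
Proof. by rewrite /guin_oudom_fun big_ord0 guin_oudom1. Qed.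

(** [guin_oudomM] allows any factor to be extracted, and the Leibniz rule splits the correction term
    according to the factor grafted upon. *)
Lemma guin_oudom_fun_rec k (f : 'I_k.+1 -> treespan) a :
  guin_oudom_fun f = graft (f a) (guin_oudom_fun (fun i => f (lift a i)))
                     - \sum_b guin_oudom_fun (graft_at (@graft R d) a b f).
Proof.
rewrite /guin_oudom_fun (bigD1_ord a) //= guin_oudomM.
apply: (congr1 (fun X => _ - X)).
rewrite (derivation_prod _ (graft_forestM (f a))) ?index_enum_uniq //.
have lin_go := linear_guin_oudom y.
rewrite (big_morph (fun X : forestspan => guin_oudom X y) (linD lin_go) (lin0 lin_go)).
apply: eq_bigr => b _; apply: (congr1 (fun X => guin_oudom X y)).
apply: eq_bigr => i _; rewrite /graft_at graft_tree_to_forest.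
by case: eqP.
Qed.

End GuinOudomGrafting.

(** * Renaming of leaf decorations *)

Section Relabelling.
Variable g : nat -> nat.

Definition relabel : btree -> btree := btree_bind (fun a => BLeaf (g a)).

Lemma relabel_recomb r s : relabel (recomb r s) = recomb (relabel r) (map relabel s).
Proof. by elim: s => //= r' s <-. Qed.

Lemma left_comb_relabel r : left_comb (relabel r) = map relabel (left_comb r).
Proof. by elim: r => //= r1 -> r2 _. Qed.

Lemma left_leaf_relabel r : left_leaf (relabel r) = g (left_leaf r).
Proof. exact: left_leaf_bind. Qed.

Lemma mL_relabel r : mL (relabel r) = mL r.
Proof. by rewrite mL_bind addn0. Qed.

Lemma mR_relabel r : mR (relabel r) = mR r.
Proof. by rewrite mR_bind addn0. Qed.

Lemma size_leaves_relabel r : size (leaves (relabel r)) = size (leaves r).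
Proof. by elim: r => //= r1 IH1 r2 IH2; rewrite !size_cat IH1 IH2. Qed.

Lemma insertion_relabel a l r : insertion (g a) l (relabel r) = relabel (insertion a l r).
Proof.
rewrite /insertion /Ppart relabel_recomb left_comb_relabel left_leaf_relabel.
rewrite -[relabel (BNode _ _)]/(BNode (BLeaf (g a)) (relabel _)) relabel_recomb.
by rewrite map_drop map_take.
Qed.

Lemma Vminus_relabel r : Vminus (relabel r) = relabel (Vminus r).
Proof.
by rewrite /Vminus relabel_recomb left_comb_relabel mL_relabel map_take last_map.
Qed.

(** The recursion sees a tree only through [mL] and [Vminus], so [J] depends on the shape alone. *)
Lemma J_rec_relabel k r l s : J_rec k (relabel r) l s = J_rec k r l s.
Proof.
elim: k => [|k IH] //= in r l s *; rewrite Vminus_relabel mL_relabel.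
by do 2?[case: ifP => _]; rewrite ?IH //; apply: eq_bigr => i _; rewrite IH.
Qed.

Lemma J_relabel r l s : J (relabel r) l s = J r l s.
Proof. by rewrite /J size_leaves_relabel J_rec_relabel. Qed.

Lemma btree_enum_map n w : btree_enum n (map g w) = map relabel (btree_enum n w).
Proof.
elim: n w => [|n IH] [|a [|b w]] //; set W := a :: b :: w.
have E W' : (1 < size W')%N -> btree_enum n.+1 W' =
    flatten [seq [seq BNode r1 r2 | r1 <- btree_enum n (take i W'),
      r2 <- btree_enum n (drop i W')] | i <- iota 1 (size W').-1].
  by case: W' => [|? []].
rewrite !E ?size_map // map_flatten -map_comp; congr flatten; apply: eq_map => i.
rewrite -[RHS]/(map relabel [seq BNode r1 r2 | r1 <- btree_enum n (take i W),
  r2 <- btree_enum n (drop i W)]).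
by rewrite -map_take -map_drop !IH allpairs_mapl allpairs_mapr map_allpairs.
Qed.

(** The leaf word contains the rightmost leaf [0], hence the condition on [g]. *)
Lemma btrees_map I : g 0 = 0%N -> btrees (map g I) = map relabel (btrees I).
Proof. by move=> g0; rewrite /btrees -[in LHS]g0 -map_cons -map_rev btree_enum_map size_map. Qed.

End Relabelling.

Lemma G_relabel (R : fieldType) (d : nat) (tau : nat -> tree d) g r :
  G R tau (relabel g r) = btree_eval (@graft R d) (fun a => tvec R (tau (g a))) r.
Proof.
elim: r => [a|r1 IH1 r2 IH2]; first by [].
by rewrite -[LHS]/(graft (G R tau (relabel g r1)) (G R tau (relabel g r2))) IH1 IH2.
Qed.

Lemma nth_one_line k (p : 'S_k) (i : 'I_k) : nth 0%N (one_line p) i = (p i).+1.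
Proof. by rewrite /one_line (nth_map i) ?size_enum_ord // nth_ord_enum. Qed.

Lemma take_one_line k (p : 'S_k.+1) :
  take k (one_line p) = map (nth 0%N (0%N :: one_line p)) (iota 1 k).
Proof.
have sz : size (one_line p) = k.+1 by rewrite size_map size_enum_ord.
apply: (@eq_from_nth _ 0%N) => [|i]; rewrite size_takel ?sz //.
  by rewrite size_map size_iota.
by move=> ik; rewrite nth_take // (nth_map 0%N) ?size_iota // nth_iota.
Qed.

Lemma scale_natV (R : fieldType) (V : lmodType R) n (v : V) :
  n%:R != 0 :> R -> n%:R^-1 *: (v *+ n) = v.
Proof. by move=> n_neq0; rewrite -scaler_nat scalerA mulVf // scale1r. Qed.

Theorem corollary4p31 (R : fieldType) (charR0 : [pchar R] =i pred0) (d k : nat)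
  (hk : (1 <= k)%N) (tau : nat -> tree d) :
  guin_oudom (\prod_(1 <= i < k.+1) fvec R (forest1 (tau i))) (tvec R (tau 0%N)) =
  (k`!%:R : R)^-1 *:
    \sum_(p : 'S_k)
      \sum_(rho <- btrees (take k.-1 (one_line p)))
        \sum_(1 <= l < (mL rho).+2)
          \sum_(j : l.-tuple 'I_k | increasing j)
            ((-1) ^+ (k - mR (insertion (nth 0%N (one_line p) k.-1) l rho)) *
             (J rho l (map val j))%:R) *:
            G R tau (insertion (nth 0%N (one_line p) k.-1) l rho).
Proof.
case: k hk => // k _; rewrite [k.+1.-1]/=.
set y := tvec R (tau 0%N).
pose f (i : 'I_k.+1) := tvec R (tau i.+1).
have -> : guin_oudom (\prod_(1 <= i < k.+2) fvec R (forest1 (tau i))) y = guin_oudom_fun y f.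
  rewrite big_add1 big_mkord; apply: (congr1 (fun X => guin_oudom X y)).
  by apply: eq_bigr => i _; rewrite tree_to_forestE.
(* Characteristic zero makes the factorial invertible. *)
have k_neq0 : (k.+1)`!%:R != 0 :> R by rewrite (proj1 (pcharf0P R) charR0) -lt0n fact_gt0.
have graftD (x : treespan R d) : {morph graft x : u v / u + v} := linD (linear_graftr x).
have sum_p := sum_perm_adjacent_graft graftD (@guin_oudom_fun0 R d y)
  (@guin_oudom_fun_rec R d y) f.
rewrite -[LHS](scale_natV _ k_neq0) -sum_p.
apply: (congr1 (fun X => _ *: X)); apply: eq_bigr => p _.
(* [g] is [p] as a relabelling fixing [0]; it reduces the leaf words prescribed by [p] to the
   standard one. *)
pose g := nth 0%N (0%N :: one_line p).
pose x a := tvec R (tau (g a)).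
rewrite (eq_adjacent_graft _ _ (g := fun i : 'I_k.+1 => x i.+1)); last first.
  by move=> i; rewrite /x -[g i.+1]/(nth 0%N (one_line p) i) nth_one_line.
rewrite -[y]/(x 0%N) (adjacent_graft_collapse (@linear_graftr R d)) -insert_collapse.
rewrite -sum_J_insert take_one_line btrees_map // big_map; apply: eq_bigr => r _.
rewrite mL_relabel; apply: eq_bigr => l _; apply: eq_bigr => j _.
rewrite -[nth _ _ k]/(g k.+1) insertion_relabel mR_relabel J_relabel G_relabel.
by rewrite /signed_eval mulr_natr -scalerMnl.
Qed.
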